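(* Let $F$ be a smooth projective curve of genus $1$ over $\mathbb{C}$, let $\beta\in\mathrm{Pic}(F)[2]$ with $\beta\neq 0$, let $H\in\mathrm{Pic}^3(F)$, and let $i:F\to\mathbb{P}^2$ be the map associated to $H$. Let $\pi:F\to F'=F/\beta$ be the quotient map, let $\beta'\in\mathrm{Pic}(F')$ be the image of the non-zero element of $\mathrm{Pic}(F)[2]/\beta$, and let $$i':F'\to(\mathbb{P}^2)^*,\qquad \{p,p+\beta\}\mapsto\overline{i(p)\,i(p+\beta)}.$$ If $p\in F$ is such that $i(p)$ is a flex (of $i(F)$), then $i'(\pi(p)+\beta')$ is a flex (of $i'(F')$).
   Context: The map $i$ associated to $H$ is the embedding of $F$ as a smooth plane cubic given by the complete linear system $|H|$. For a smooth genus $1$ curve $C$, the group $\mathrm{Pic}^0(C)$ acts on $C$ by translation: for $p\in C$ and $\delta\in\mathrm{Pic}^0(C)$, $p+\delta$ is the unique point of $C$ whose divisor class is $[p]+\delta$. $\mathrm{Pic}(F)[2]$ denotes the $2$-torsion subgroup of $\mathrm{Pic}(F)$ (it lies in $\mathrm{Pic}^0(F)$), and $\mathrm{Pic}(F)[2]/\beta$ is its quotient by the subgroup $\{0,\beta\}$, a group of order $2$. $F/\beta$ is the quotient of $F$ by the translation $p\mapsto p+\beta$; it is a smooth genus $1$ curve whose points are the pairs $\{p,p+\beta\}$. The image $\beta'$ of the class of $\gamma\in\mathrm{Pic}(F)[2]\setminus\{0,\beta\}$ is its image under the homomorphism $\mathrm{Pic}^0(F)\to\mathrm{Pic}^0(F')$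 induced by $\pi$ (push-forward of divisors), so that $\pi(p)+\beta'=\pi(p+\gamma)=\{p+\gamma,p+\gamma+\beta\}$. $(\mathbb{P}^2)^*$ is the dual projective plane, whose points are the lines in $\mathbb{P}^2$, and $\overline{xy}$ denotes the line through two distinct points $x,y$. For a smooth curve $C$ mapped to a projective plane by a morphism $j$ whose image is not contained in a line, $j(c)$ is called a flex if there is a line in the plane whose pullback to $C$ under $j$ has multiplicity at least $3$ at $c$. *)

(* Defs.v *)
(* A smooth projective curve over an algebraically closed field k is encoded
   by its function field K, a finitely generated extension of k of
   transcendence degree 1: its points are the discrete valuation rings of K/k
   (the "abstract nonsingular curve" of K/k), and non-constant morphisms of
   curves are k-embeddings of function fields in the opposite direction. *)
From HB Require Import structures.
From mathcomp Require Import all_boot all_order all_algebra.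
From mathcomp Require Import boolp classical_sets reals.
From mathcomp.real_closed Require Import complex.
From mathcomp.multinomials Require Import freeg.

Set Implicit Arguments.
Unset Strict Implicit.
Unset Printing Implicit Defensive.

Import Order.TTheory GRing.Theory Num.Theory.

Local Open Scope ring_scope.
Local Open Scope quotient_scope.

Record curve (k : closedFieldType) := Curve {
  funfield :> fieldType;
  const : {rmorphism k -> funfield};
  (* funfield is a finite extension of k(x), with x transcendental over k;
     denominators q(x) have been cleared *)
  curveP : exists2 x : funfield, ~ algebraicOver const x &
    exists n (e : 'I_n -> funfield), forall f : funfield,
    exists (q : {poly k}) (p : 'I_n -> {poly k}), q != 0 /\
      (map_poly const q).[x] * f = \sum_(j < n) (map_poly const (p j)).[x] * e j
}.

(* The order of vanishing at 0 is infinite; [vord 0 = 0] is a junk value which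
   makes a point determined by its valuation.  Use [vord_ge] below when the
   function may vanish identically. *)
Record cpoint (k : closedFieldType) (X : curve k) := Point {
  vord : X -> int;
  vord0 : vord 0 = 0;
  vordM : forall f g, f != 0 -> g != 0 -> vord (f * g) = vord f + vord g;
  vordD : forall f g, f != 0 -> g != 0 -> f + g != 0 ->
    Num.min (vord f) (vord g) <= vord (f + g);
  vord_const : forall c, vord (const X c) = 0;
  vord_normalized : exists t, vord t = 1
}.

HB.instance Definition _ (k : closedFieldType) (X : curve k) :=
  gen_eqMixin (cpoint X).
HB.instance Definition _ (k : closedFieldType) (X : curve k) :=
  gen_choiceMixin (cpoint X).

Section Curve.
Variables (k : closedFieldType) (X : curve k).
Implicit Types (P : cpoint X) (f : X) (D : {freeg (cpoint X) / int}).

Definition vord_ge P (n : int) f := f = 0 \/ n <= vord P f.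

(* f is regular at P and f(P) = c *)
Definition has_value P f (c : k) := vord_ge P 1 (f - const X c).

Definition principal : {pred {freeg (cpoint X) / int}} :=
  [pred D | `[< exists2 f, f != 0 & forall P, coeff P D = vord P f >]].

Lemma vord1 P : vord P 1 = 0.
Proof. by rewrite -(rmorph1 (const X)) vord_const. Qed.

Lemma vordV P f : f != 0 -> vord P f^-1 = - vord P f.
Proof.
move=> f0; apply/eqP; rewrite -addr_eq0 -vordM ?invr_eq0 //.
by rewrite mulVf // vord1.
Qed.

Lemma principal_zmod_closed : zmod_closed principal.
Proof.
split; first by apply/asboolP; exists 1; rewrite ?oner_neq0 // => P;
  rewrite coeff0 vord1.
move=> D E /asboolP[f f0 Df] /asboolP[g g0 Eg].
apply/asboolP; exists (f / g); first by rewrite mulf_neq0 ?invr_eq0.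
by move=> P; rewrite coeffB Df Eg vordM ?invr_eq0 // vordV.
Qed.

HB.instance Definition _ :=
  GRing.isZmodClosed.Build _ principal principal_zmod_closed.

Definition Pic := Quotient.quot principal.

HB.instance Definition _ := GRing.Zmodule.on Pic.

Definition divcl D : Pic := \pi_(Quotient.quot principal) D.

(* delta lies in Pic^n; as k is algebraically closed every point has degree 1,
   so the degree of a divisor is the sum of its coefficients *)
Definition in_Pic_deg (n : int) (delta : Pic) :=
  exists2 D, divcl D = delta & deg D = n.

(* p + delta; the default value P is never used for X of genus 1 and delta of
   degree 0 *)
Definition translate P (delta : Pic) : cpoint X :=
  xget P [set Q | divcl << Q >> = divcl << P >> + delta]%classic.

(* the Riemann-Roch space L(D) = H^0(O(D)) *)
Definition Lspace D f := forall P, vord_ge P (- coeff P D) f.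

Definition lincomb n (c : 'rV[k]_n) (f : 'rV[X]_n) : X :=
  \sum_(j < n) const X (c 0 j) * f 0 j.

Definition is_basis_L D n (f : 'rV[X]_n) :=
  (forall j, Lspace D (f 0 j)) /\
  (forall g, Lspace D g -> exists! c : 'rV[k]_n, g = lincomb c f).

Definition dim_L D n := exists f : 'rV[X]_n, is_basis_L D f.

(* Riemann's theorem: the genus is the maximum of deg D + 1 - dim L(D) *)
Definition has_genus (g : nat) :=
  (forall D, exists2 n, dim_L D n & deg D + 1 - n%:Z <= g%:Z) /\
  (exists D, exists2 n, dim_L D n & deg D + 1 - n%:Z = g%:Z).

End Curve.

Definition P2 (k : fieldType) := {V : {vspace 'rV[k]_3} | \dim V == 1%N}.

(* a point of the dual plane with homogeneous coordinates [a_0 : a_1 : a_2] is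
   the line a_0 x_0 + a_1 x_1 + a_2 x_2 = 0 *)
Definition dualP2 (k : fieldType) := P2 k.

Definition on_line (k : fieldType) (x : P2 k) (l : dualP2 k) :=
  forall u a : 'rV[k]_3, u \in val x -> a \in val l ->
    \sum_(j < 3) a 0 j * u 0 j = 0.

(* l is the line through x and y; determines l when x and y are distinct *)
Definition line_through (k : fieldType) (x y : P2 k) (l : dualP2 k) :=
  on_line x l /\ on_line y l.

Section MapsToPlane.
Variables (k : closedFieldType) (X : curve k).

(* near P the rational map [g_0 : g_1 : g_2] is given by the regular functions
   h g_0, h g_1, h g_2, whose values u_0, u_1, u_2 at P are not all zero *)
Definition local_coords (g : 'rV[X]_3) (P : cpoint X) (h : X) (u : 'rV[k]_3) :=
  u != 0 /\ forall j, has_value P (h * g 0 j) (u 0 j).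

Definition given_by (g : 'rV[X]_3) (j : cpoint X -> P2 k) :=
  forall P, exists h u, local_coords g P h u /\ val (j P) = <[u]>%VS.

Definition linear_system_map (H : Pic X) (i : cpoint X -> P2 k) :=
  exists D (f : 'rV[X]_3), [/\ divcl D = H, is_basis_L D f & given_by f i].

(* the pullback of the line l under the morphism given by g has multiplicity
   at least n at c *)
Definition pullback_mult_ge (g : 'rV[X]_3) (c : cpoint X) (l : dualP2 k)
    (n : nat) :=
  exists h u a, [/\ local_coords g c h u, val l = <[a]>%VS &
    vord_ge c n%:Z (h * lincomb a g)].

(* j(c) is a flex; this includes that j is a morphism whose image is not
   contained in a line *)
Definition is_flex (j : cpoint X -> P2 k) (c : cpoint X) :=
  exists g, [/\ given_by g j,
    (forall l, exists P, ~ on_line (j P) l) &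
    exists l, pullback_mult_ge g c l 3].

End MapsToPlane.

(* Non-constant morphisms.  [mor P] is the point whose valuation ring is the
   inverse image of that of P, so it is determined by [pullback]. *)
Record cmorphism (k : closedFieldType) (X Y : curve k) := Morphism {
  mor :> cpoint X -> cpoint Y;
  pullback : {rmorphism Y -> X};
  pullback_const : forall c, pullback (const Y c) = const X c;
  mor_vord : forall P, exists2 e : nat, (0 < e)%N &
    forall f, vord P (pullback f) = e%:Z * vord (mor P) f
}.

Section Morphisms.
Variables (k : closedFieldType) (X Y : curve k) (phi : cmorphism X Y).

Definition push (D : {freeg (cpoint X) / int}) : {freeg (cpoint Y) / int} :=
  fglift (fun P => << phi P >>) D.

(* push-forward of divisor classes; it is independent of the chosen
   representative because push maps div f to the divisor of the norm of f *)
Definition Pic_push (delta : Pic X) : Pic Y :=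
  divcl (push (repr (delta : Quotient.quot (@principal k X)))).

(* phi is the quotient of X by the translation P |-> P + beta, for beta of
   order 2: its fibres are the pairs {P, P + beta}, and the rational functions
   on Y are the rational functions on X invariant under the translation *)
Definition quotient_by (beta : Pic X) :=
  [/\ forall Q, exists P, phi P = Q,
      forall P Q, phi P = phi Q <-> Q = P \/ Q = translate P beta &
      forall f : X, (exists g, f = pullback phi g) <->
        forall P c, has_value P f c <-> has_value (translate P beta) f c].

End Morphisms.

(* Main.v *)
Require Import Defs.
From HB Require Import structures.
From mathcomp Require Import all_boot all_order all_algebra.
From mathcomp Require Import boolp classical_sets reals.
From mathcomp.real_closed Require Import complex.
From mathcomp.multinomials Require Import freeg.
From mathcomp Require Import zify ring.

Set Implicit Arguments.
Unset Strict Implicit.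
Unset Printing Implicit Defensive.

Import Order.TTheory GRing.Theory Num.Theory.
Local Open Scope ring_scope.

(** Put the origin at the flex [p]. Then [H] is the class of [3 p], the reflection
    [P |-> - P] extends to the plane as a projective involution, and so it acts on
    the dual plane, compatibly with [i']. If [i] is given by the Weierstrass
    coordinates [1, x, y], the involution changes the sign of [y]. It fixes
    [pi(gamma)], and the line [i'(pi(gamma))], which contains the images of
    [gamma], [gamma + beta] and [beta], is [y = 0]: an isolated fixed point of the
    involution on the dual plane. So in affine coordinates centred there the
    involution is multiplication by [- 1], and [i'] is given near [pi(gamma)] by
    two odd functions of a local parameter. A linear combination of them has no
    linear term; being odd, it vanishes to order 3, and this is the flex line.

    On function fields: [t] is the automorphism given by the translation by
    [beta], and [i'] is given by the minors
    [x t(y) - y t(x)], [y - t(y)], [t(x) - x] of the matrix with rows [1, x, y] and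
    [1, t(x), t(y)]. The first two are odd under the reflection, so that
    [odd_combination] applies to them; [dual_flex_line] transports the result to an
    arbitrary basis of the linear system, and [dual_flex] to the quotient curve.

    Points are valuations here, so the geometry of the curve comes from the
    dimensions of the spaces [L(D)]. The genus hypothesis gives
    [dim L(D) >= deg D], with equality for one [D]. That principal divisors have
    degree 0 follows because powers of a function would otherwise embed spaces of
    growing dimension into [L(0)]; that a function with at most one simple pole is
    constant follows from the case of equality ([Lspace1_const]). Together they
    give [dim L(D) = deg D] for [deg D > 0] ([dim_L_deg]) and the bijection
    between points and classes of degree 1.

    Automorphisms come from functions [x] with two poles [A], [B]: the field is a
    quadratic extension of [k(x)], and its conjugation acts on points as the
    reflection [P |-> A + B - P] ([involution_of_pencil]). A product of two
    reflections is a translation ([translation_ex]). At a fixed point of a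
    reflection odd functions have odd order ([odd_order]).

    An invariant function with at most three poles is constant
    ([invariant_const]): otherwise its fibres are the pairs [q], [q + beta], hence
    [2 q] is independent of [q] and some reflection is the identity. This is used
    twice. Two points of the quotient with the same class are equal, which with
    the norm [f t(f)] identifies the translate of [pi(p)] by the push-forward of
    [gamma] as [pi(p + gamma)] ([translate_quotient]). And the lines
    [i(P) i(P + beta)] do not all pass through one point, since the projection from
    that point would be invariant ([dual_triple_free]). *)

(** * Orders and values of functions at a point *)

Section Valuations.
Variables (k : closedFieldType) (X : curve k).
Implicit Types (P Q : cpoint X) (f g : X) (n m : int) (c d : k).
Local Notation C := (const X).

Lemma vord_geE P n f : f != 0 -> vord_ge P n f -> n <= vord P f.
Proof. by move=> /eqP f0 []. Qed.

Lemma vord_geI P f : vord_ge P (vord P f) f. Proof. by right. Qed.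

Lemma vord_geW P n m f : n <= m -> vord_ge P m f -> vord_ge P n f.
Proof. by move=> nm [->|mf]; [left|right; apply: le_trans mf]. Qed.

Lemma const_neq0 c : c != 0 -> C c != 0. Proof. by rewrite fmorph_eq0. Qed.

Lemma vord_geC P c : vord_ge P 0 (C c). Proof. by right; rewrite vord_const. Qed.

Lemma vord_geM P n m f g :
  vord_ge P n f -> vord_ge P m g -> vord_ge P (n + m) (f * g).
Proof.
have [->|f0] := eqVneq f 0; first by rewrite mul0r; left.
have [->|g0] := eqVneq g 0; first by rewrite mulr0; left.
by move=> /(vord_geE f0) nf /(vord_geE g0) mg; right; rewrite vordM // lerD.
Qed.

Lemma vord_geZ P n c f : vord_ge P n f -> vord_ge P n (C c * f).
Proof. by move=> /(vord_geM (vord_geC P c)); rewrite add0r. Qed.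

Lemma vord_geN P n f : vord_ge P n f -> vord_ge P n (- f).
Proof. by move=> /(vord_geZ (-1)); rewrite rmorphN1 mulN1r. Qed.

Lemma vord_geD P n f g : vord_ge P n f -> vord_ge P n g -> vord_ge P n (f + g).
Proof.
have [->|f0] := eqVneq f 0; first by rewrite add0r.
have [->|g0] := eqVneq g 0; first by rewrite addr0.
have [->|fg0] := eqVneq (f + g) 0; first by left.
move=> /(vord_geE f0) nf /(vord_geE g0) ng; right.
by apply: le_trans (vordD P f0 g0 fg0); rewrite le_min nf.
Qed.

Lemma vord_geB P n f g : vord_ge P n f -> vord_ge P n g -> vord_ge P n (f - g).
Proof. by move=> nf /vord_geN; apply: vord_geD. Qed.

Lemma vord_ge_sum P n (I : Type) (r : seq I) (Pr : pred I) (F : I -> X) :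
  (forall j, Pr j -> vord_ge P n (F j)) -> vord_ge P n (\sum_(j <- r | Pr j) F j).
Proof.
by move=> H; elim/big_ind: _ => //; [left | move=> ? ?; apply: vord_geD].
Qed.

Lemma vord_geX P f : vord_ge P 0 f -> forall i : nat, vord_ge P 0 (f ^+ i).
Proof.
move=> f0; elim=> [|i IH]; first by rewrite expr0 -(rmorph1 C); apply: vord_geC.
by rewrite exprS -[0]addr0; apply: vord_geM.
Qed.

Lemma vordN P f : vord P (- f) = vord P f.
Proof.
have [->|f0] := eqVneq f 0; first by rewrite oppr0.
rewrite -mulN1r -(rmorphN1 C) vordM //; first by rewrite vord_const add0r.
by rewrite fmorph_eq0 oppr_eq0 oner_eq0.
Qed.

Lemma vordZ P c f : c != 0 -> vord P (C c * f) = vord P f.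
Proof.
move=> c0; have [->|f0] := eqVneq f 0; first by rewrite mulr0.
by rewrite vordM ?const_neq0 // vord_const add0r.
Qed.

Lemma vordX P f (i : nat) : f != 0 -> vord P (f ^+ i) = i%:Z * vord P f.
Proof.
move=> f0; elim: i => [|i IH]; first by rewrite vord1 mul0r.
by rewrite exprS vordM ?expf_neq0 // IH; lia.
Qed.

Lemma vord_div P f g : f != 0 -> g != 0 -> vord P (f / g) = vord P f - vord P g.
Proof. by move=> f0 g0; rewrite vordM ?invr_eq0 // vordV. Qed.

Lemma vordXz P f (n : int) : f != 0 -> vord P (f ^ n) = n * vord P f.
Proof.
move=> f0; case: n => i; first by rewrite -exprnP vordX.
by rewrite NegzE -exprnN vordV ?expf_neq0 // vordX // mulNr.
Qed.

(** The equality case of the ultrametric inequality. *)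
Lemma vord_addl P f g : f != 0 -> vord_ge P (vord P f + 1) g ->
  f + g != 0 /\ vord P (f + g) = vord P f.
Proof.
move=> f0 Hg; have [->|g0] := eqVneq g 0; first by rewrite addr0.
have {}Hg := vord_geE g0 Hg.
have fg0 : f + g != 0.
  apply/eqP => /eqP; rewrite addr_eq0 => /eqP fE.
  by move: Hg; rewrite fE vordN; lia.
split=> //; apply/eqP; rewrite eq_le; apply/andP; split; last first.
  by apply: le_trans (vordD P f0 g0 fg0); rewrite le_min; lia.
have Ng : - g != 0 by rewrite oppr_eq0.
have := vordD P fg0 Ng; rewrite addrK => /(_ f0).
by rewrite ge_min vordN => /orP[|]; lia.
Qed.

Lemma has_value_ge0 P f c : has_value P f c -> vord_ge P 0 f.
Proof.
move=> H; rewrite -(subrK (C c) f).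
by apply: vord_geD; [apply: vord_geW H | apply: vord_geC].
Qed.

Lemma has_value0 P f : has_value P f 0 <-> vord_ge P 1 f.
Proof. by rewrite /has_value rmorph0 subr0. Qed.

Lemma has_valueC P c : has_value P (C c) c.
Proof. by rewrite /has_value subrr; left. Qed.

Lemma has_valueD P f g c d :
  has_value P f c -> has_value P g d -> has_value P (f + g) (c + d).
Proof. by move=> H /(vord_geD H); rewrite /has_value rmorphD opprD addrACA. Qed.

Lemma has_valueN P f c : has_value P f c -> has_value P (- f) (- c).
Proof. by move=> /vord_geN; rewrite /has_value rmorphN opprB opprK addrC. Qed.

Lemma has_valueB P f g c d :
  has_value P f c -> has_value P g d -> has_value P (f - g) (c - d).
Proof. by move=> H /has_valueN; apply: has_valueD. Qed.

Lemma has_valueM P f g c d :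
  has_value P f c -> has_value P g d -> has_value P (f * g) (c * d).
Proof.
move=> Hf Hg; rewrite /has_value.
have -> : f * g - C (c * d) = (f - C c) * g + C c * (g - C d).
  by rewrite rmorphM; ring.
apply: vord_geD; last by apply: vord_geZ.
by rewrite -[1]addr0; apply: vord_geM => //; apply: has_value_ge0 Hg.
Qed.

Lemma has_value_sum P (I : Type) (r : seq I) (F : I -> X) (u : I -> k) :
  (forall j, has_value P (F j) (u j)) ->
  has_value P (\sum_(j <- r) F j) (\sum_(j <- r) u j).
Proof.
move=> H; elim/big_ind2: _ => //; last by move=> ? ? ? ? ? ?; apply: has_valueD.
by apply/has_value0; left.
Qed.

Lemma has_value_inj P f c d : has_value P f c -> has_value P f d -> c = d.
Proof.
move=> Hc Hd; apply/eqP; rewrite -subr_eq0; apply/negPn/negP => cd.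
have := has_valueB Hc Hd; rewrite subrr => /has_valueN.
rewrite oppr0 /has_value sub0r rmorphN opprK => /vord_geE.
by rewrite const_neq0 // vord_const => /(_ isT).
Qed.

Lemma has_value_unit P f c : has_value P f c -> c != 0 -> f != 0 /\ vord P f = 0.
Proof.
move=> H c0; rewrite -(subrK (C c) f) addrC -(vord_const P c).
by apply: vord_addl; rewrite ?const_neq0 // vord_const add0r.
Qed.

Lemma has_valueV P f c : has_value P f c -> c != 0 -> has_value P f^-1 c^-1.
Proof.
move=> H c0; have [f0 vf] := has_value_unit H c0.
rewrite /has_value.
have -> : f^-1 - C c^-1 = - ((f - C c) / (f * C c)).
  by rewrite fmorphV; field; rewrite f0 ?fmorph_eq0 c0.
apply: vord_geN; rewrite -[1]addr0; apply: vord_geM => //; right.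
by rewrite vordV ?mulf_neq0 ?const_neq0 // vordM ?const_neq0 // vf vord_const.
Qed.

Lemma cpoint_eq P Q : (forall f, vord P f = vord Q f) -> P = Q.
Proof.
case: P Q => [v a b c d e] [v' a' b' c' d' e'] /= H.
have E : v = v' by apply: funext.
subst v'; rewrite (Prop_irrelevance a a') (Prop_irrelevance b b').
by rewrite (Prop_irrelevance c c') (Prop_irrelevance d d') (Prop_irrelevance e e').
Qed.

Lemma deg_pt P : deg << P >> = 1 :> int. Proof. exact: degU. Qed.

Lemma coeff_0 P : coeff P (0%R : {freeg (cpoint X) / int}) = 0 :> int. Proof. exact: coeff0. Qed.

Lemma degB1 D P : deg (D - << P >>) = deg D - 1.
Proof. by rewrite degB deg_pt. Qed.

Lemma coeff_pt P Q : coeff Q << P >> = (P == Q)%:Z.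
Proof. by rewrite coeffU mul1r; case: eqP. Qed.

Lemma coeffB1 D P Q : coeff Q (D - << P >>) = coeff Q D - (P == Q)%:Z.
Proof. by rewrite coeffB coeff_pt. Qed.

Lemma Lspace_sub D f P : Lspace D f -> f != 0 ->
  - coeff P D < vord P f -> Lspace (D - << P >>) f.
Proof.
move=> Hf f0 HP Q; right; have := vord_geE f0 (Hf Q).
rewrite coeffB1.
by have [<-|_] := eqVneq P Q; rewrite ?subr0 //; lia.
Qed.

Lemma Lspace_addpt D P f : Lspace (D - << P >>) f -> Lspace D f.
Proof.
move=> H Q; apply: vord_geW (H Q); rewrite coeffB1.
by case: eqP => _ /=; lia.
Qed.

End Valuations.

(** * Residue fields *)

Section Residue.
Variables (k : closedFieldType) (X : curve k).
Implicit Types (P Q : cpoint X) (f g x y : X) (c d : k).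
Local Notation C := (const X).

Definition ev x (p : {poly k}) : X := (map_poly C p).[x].

HB.instance Definition _ x :=
  GRing.RMorphism.copy (ev x) (horner_eval x \o map_poly C).

Lemma evC x c : ev x c%:P = C c.
Proof. by rewrite /ev map_polyC hornerC. Qed.

Lemma evX x : ev x 'X = x.
Proof. by rewrite /ev map_polyX hornerX. Qed.

Definition transcendental x := forall p, p != 0 -> ev x p != 0.

Definition algebraic_on x f :=
  exists2 p : {poly {poly k}}, p != 0 & (map_poly (ev x) p).[f] = 0.

(** Multiplication by [f] acts on the finite-dimensional [k(x)]-space [X], so
    [f] is a root of a characteristic polynomial, once the denominators [q] have
    been absorbed by the substitution of [q f]. *)
Lemma curve_algebraic : exists2 x, transcendental x & forall f, algebraic_on x f.
Proof.
have [x xtr [n [e gen]]] := curveP X; exists x.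
  by move=> p p0; apply/negP => px; case: xtr; exists p.
have {}xtr : transcendental x.
  by move=> p p0; apply/negP => px; case: xtr; exists p.
move=> f.
have /choice[qp Hqp] (j : 'I_n) : exists qp : {poly k} * ('I_n -> {poly k}),
    qp.1 != 0 /\ ev x qp.1 * (f * e j) = \sum_(l < n) ev x (qp.2 l) * e l.
  by have [q [p []]] := gen (f * e j); exists (q, p).
pose q := \prod_(j < n) (qp j).1.
have q0 : q != 0 by apply/prodf_neq0 => j _; case: (Hqp j).
pose A : 'M_n := \matrix_(l, j) ((\prod_(i < n | i != j) (qp i).1) * (qp j).2 l).
pose v := \row_j e j.
have vA : v *m map_mx (ev x) A = (ev x q * f) *: v.
  apply/rowP => j; have [_ E] := Hqp j; rewrite !mxE.
  transitivity (ev x (\prod_(i < n | i != j) (qp i).1) *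
                (ev x (qp j).1 * (f * e j))).
    rewrite E mulr_sumr; apply: eq_bigr => l _.
    by rewrite !mxE [ev x (_ * _)]rmorphM; ring.
  have -> : q = (qp j).1 * \prod_(i < n | i != j) (qp i).1 by exact: bigD1.
  by rewrite [ev x (_ * _)]rmorphM; ring.
have v0 : v != 0.
  apply/eqP => v0; have [r [p [r0]]] := gen 1.
  rewrite mulr1 big1 => [|j _]; first by apply/eqP; apply: xtr.
  have /rowP/(_ j) := v0; rewrite !mxE => ->; exact: mulr0.
have : root (char_poly (map_mx (ev x) A)) (ev x q * f).
  by rewrite -eigenvalue_root_char; apply/eigenvalueP; exists v.
rewrite -map_char_poly => /eqP rt.
exists (char_poly A \Po (q *: 'X)).
  rewrite comp_poly_eq0 ?monic_neq0 ?char_poly_monic //.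
  by rewrite size_scale // size_polyX.
rewrite map_comp_poly horner_comp -[RHS]rt; congr _.[_].
by rewrite map_polyZ map_polyX hornerZ hornerX.
Qed.

Lemma ev_factor x p : exists s : seq k,
  ev x p = C (lead_coef p) * \prod_(z <- s) (x - C z).
Proof.
have [s ps] := closed_field_poly_normal p; exists s.
rewrite {1}ps /ev map_polyZ hornerZ rmorph_prod horner_prod; congr (_ * _).
by apply: eq_bigr => z _; rewrite rmorphB /= map_polyX map_polyC !hornerE.
Qed.

Lemma ev_unit P f : (forall z, f - C z != 0 /\ vord P (f - C z) = 0) ->
  forall p, p != 0 -> ev f p != 0 /\ vord P (ev f p) = 0.
Proof.
move=> H p p0; have [s ->] := ev_factor f p.
have [s0 vs] : \prod_(z <- s) (f - C z) != 0 /\ vord P (\prod_(z <- s) (f - C z)) = 0.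
  elim/big_ind: _ => //; first by rewrite oner_eq0 vord1.
  by move=> g h [g0 vg] [h0 vh]; rewrite mulf_neq0 // vordM // vg vh.
by rewrite mulf_neq0 ?const_neq0 ?lead_coef_eq0 // vordZ ?lead_coef_eq0.
Qed.

Lemma min_vord P n (g : 'I_n -> X) : (exists j, g j != 0) ->
  exists2 j0, g j0 != 0 & forall j, vord_ge P (vord P (g j0)) (g j).
Proof.
case=> i gi; case: (@arg_minP _ _ _ i (fun j => g j != 0) (fun j => vord P (g j)) gi) => j0 gj0 H.
exists j0 => // j; have [->|gj] := eqVneq (g j) 0; [by left|by right; apply: H].
Qed.

(** A valuation of [X] is non-trivial on [k(x)]: otherwise, in an algebraic
    equation for a uniformizer, the term of least degree dominates. *)
Lemma vord_nontrivial P x : transcendental x -> (forall f, algebraic_on x f) ->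
  exists2 p, p != 0 & vord P (ev x p) != 0.
Proof.
move=> xtr alg; apply: contrapT => H.
have {}H p : p != 0 -> vord P (ev x p) = 0.
  by move=> p0; apply/eqP/negPn/negP => vp; apply: H; exists p.
have [t vt] := vord_normalized P.
have t0 : t != 0 by apply/eqP => t0; move: vt; rewrite t0 vord0.
have [p p0 pt] := alg t.
have exn : exists i, p`_i != 0.
  by exists (size p).-1; rewrite -lead_coefE lead_coef_eq0.
pose i := ex_minn exn; have [pi mini] : p`_i != 0 /\ forall j, p`_j != 0 -> (i <= j)%N.
  by rewrite /i; case: ex_minnP.
have ilt : (i < size p)%N by apply: contraNltn pi => /leq_sizeP/(_ _ (leqnn _))->.
move: pt; rewrite (@horner_coef_wide _ (size p)) ?size_poly //.
rewrite (bigD1 (Ordinal ilt)) //= coef_map /=.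
have vi : vord P (ev x p`_i * t ^+ i) = i.
  by rewrite vordM ?expf_neq0 ?xtr // H // vordX // vt; lia.
have f0 : ev x p`_i * t ^+ i != 0 by rewrite mulf_neq0 ?expf_neq0 ?xtr.
set g := \sum_(_ | _) _; have Hg : vord_ge P (vord P (ev x p`_i * t ^+ i) + 1) g.
  rewrite vi; apply: vord_ge_sum => j ji; rewrite coef_map /=.
  have [->|pj] := eqVneq (p`_j) 0; first by rewrite [ev x 0]rmorph0 mul0r; left.
  right; rewrite vordM ?expf_neq0 ?xtr // H // vordX // vt.
  have := mini j pj; have : nat_of_ord j <> i by move=> E; case/eqP: ji; apply: val_inj.
  by lia.
by have [/eqP] := vord_addl f0 Hg.
Qed.

(** The elements [c y^m u] with [u(P) = 1]; they form a group, and for a suitable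
    [y] it contains [k(x)^*], which therefore has residue field [k] at [P]. *)
Definition monomial_at P y f :=
  exists c (m : int) u, [/\ c != 0, f = C c * y ^ m * u & has_value P u 1].

Lemma monomial_atM P y f g : y != 0 ->
  monomial_at P y f -> monomial_at P y g -> monomial_at P y (f * g).
Proof.
move=> y0 [c [m [u [c0 -> u1]]]] [d [n [w [d0 -> w1]]]].
exists (c * d), (m + n), (u * w); split; first exact: mulf_neq0.
  by rewrite rmorphM expfzDr //; ring.
by have := has_valueM u1 w1; rewrite mulr1.
Qed.

Lemma monomial_atV P y f : y != 0 -> monomial_at P y f -> monomial_at P y f^-1.
Proof.
move=> y0 [c [m [u [c0 -> u1]]]]; exists c^-1, (- m), u^-1; split.
- by rewrite invr_eq0.
- by rewrite !invfM fmorphV invr_expz.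
- by have := has_valueV u1 (oner_neq0 _); rewrite invr1.
Qed.

Lemma monomial_at_value P y f : y != 0 -> vord P y != 0 -> monomial_at P y f ->
  vord_ge P 0 f -> exists c, has_value P f c.
Proof.
move=> y0 vy [c [m [u [c0 fE u1]]]] Hf.
have [u0 vu] := has_value_unit u1 (oner_neq0 _).
have ym0 : y ^ m != 0 by rewrite expfz_neq0.
have f0 : f != 0 by rewrite fE !mulf_neq0 ?const_neq0.
have vf : vord P f = m * vord P y.
  by rewrite fE -mulrA vordZ // vordM // vu addr0 vordXz.
have := vord_geE f0 Hf; rewrite le_eqVlt => /orP[/eqP E|lt0].
  move: E; rewrite vf => /esym/eqP; rewrite mulf_eq0 (negPf vy) orbF => /eqP m0.
  exists c; rewrite fE m0 expr0z mulr1 -[X in has_value _ _ X]mulr1.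
  by apply: has_valueM => //; apply: has_valueC.
by exists 0; apply/has_value0; right; lia.
Qed.

Lemma monomial_at_ev P x : transcendental x -> (forall f, algebraic_on x f) ->
  exists y, [/\ y != 0, vord P y != 0 &
    forall p, p != 0 -> monomial_at P y (ev x p)].
Proof.
move=> xtr alg.
have x0 : x != 0 by rewrite -(evX x); apply: xtr; rewrite polyX_eq0.
have xz z : x - C z != 0.
  have /xtr : 'X - z%:P != 0 :> {poly k} by rewrite polyXsubC_eq0.
  by rewrite [ev x _]rmorphB /= evX evC.
have lin y : y != 0 -> (forall z, monomial_at P y (x - C z)) ->
    forall p, p != 0 -> monomial_at P y (ev x p).
  move=> y0 H p p0; have [s ->] := ev_factor x p.
  apply: monomial_atM => //.
    exists (lead_coef p), 0, 1; rewrite lead_coef_eq0 expr0z !mulr1; split=> //.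
    by rewrite -(rmorph1 C); apply: has_valueC.
  elim/big_ind: _ => //; last by move=> *; apply: monomial_atM.
  exists 1, 0, 1; rewrite oner_neq0 rmorph1 expr0z !mulr1; split=> //.
  by rewrite -(rmorph1 C); apply: has_valueC.
have [vx|vx] := ltP (vord P x) 0.
  exists x; split=> //; first by rewrite lt_eqF.
  apply: lin => // z; exists 1, 1, (1 - C z * x^-1); split; first exact: oner_neq0.
    by rewrite rmorph1 expr1z; field.
  rewrite -[X in has_value _ _ X]subr0; apply: has_valueB.
    by rewrite -(rmorph1 C); apply: has_valueC.
  by apply/has_value0/vord_geZ; right; rewrite vordV //; lia.
have [[a va]|na] := pselect (exists a, 0 < vord P (x - C a)).
  exists (x - C a); split=> //; first by rewrite gt_eqF.
  apply: lin => // z; have [->|za] := eqVneq z a.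
    exists 1, 1, 1; rewrite oner_neq0 rmorph1 expr1z mul1r mulr1; split=> //.
    by rewrite -(rmorph1 C); apply: has_valueC.
  have az : a - z != 0 by rewrite subr_eq0 eq_sym.
  exists (a - z), 0, (C (a - z)^-1 * (x - C z)); split=> //.
    by rewrite expr0z mulr1 mulrA -rmorphM mulfV // rmorph1 mul1r.
  rewrite -(mulVf az); apply: has_valueM; first exact: has_valueC.
  by apply: has_valueB; [right|apply: has_valueC].
have [p p0 /eqP[]] := vord_nontrivial P xtr alg.
apply: (ev_unit _ p0).2 => z; split=> //; apply/eqP; rewrite eq_le.
apply/andP; split; first by rewrite leNgt; apply/negP => H; apply: na; exists z.
by apply: vord_geE => //; apply: vord_geB; [right|apply: vord_geC].
Qed.

(** Dividing an algebraic equation of [f] over [k(x)] by a coefficient of least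
    order and taking values at [P] gives an equation over [k] for the residue of
    [f], and [k] is algebraically closed. *)
Lemma residue P f : vord_ge P 0 f -> exists c, has_value P f c.
Proof.
move=> Hf; have [x xtr alg] := curve_algebraic.
have [y [y0 vy mon]] := monomial_at_ev P xtr alg.
have [p p0 pf] := alg f.
have [|j0 gj0 minj] := @min_vord P _ (fun j : 'I_(size p) => ev x p`_j).
  have sp : ((size p).-1 < size p)%N by rewrite ltn_predL lt0n size_poly_eq0.
  by exists (Ordinal sp); apply: xtr; rewrite /= -lead_coefE lead_coef_eq0.
pose b (j : 'I_(size p)) := ev x p`_j / ev x p`_j0.
have pj0 : p`_j0 != 0 by apply: contraNneq gj0 => ->; rewrite [ev x 0]rmorph0.
have /choice[a Ha] (j : 'I_(size p)) : exists c, has_value P (b j) c.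
  have [pj|pj] := eqVneq p`_j 0.
    by exists 0; apply/has_value0; rewrite /b pj [ev x 0]rmorph0 mul0r; left.
  apply: (monomial_at_value y0 vy).
    by apply: monomial_atM => //; [|apply: monomial_atV => //]; apply: mon.
  right; rewrite vord_div ?xtr //.
  by have := vord_geE _ (minj j); rewrite xtr // => /(_ isT); lia.
have a1 : a j0 = 1.
  apply: has_value_inj (Ha j0) _; rewrite /b divff // -(rmorph1 C).
  exact: has_valueC.
pose q := \poly_(j < size p) (if insub j is Some j' then a j' else 0).
have qj (j : 'I_(size p)) : q`_j = a j by rewrite coef_poly ltn_ord valK.
have q0 : q != 0.
  by apply/eqP => q0; have := qj j0; rewrite q0 coef0 a1 => /esym/eqP; rewrite oner_eq0.
have Hq : vord_ge P 1 (ev f q).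
  have -> : ev f q = \sum_(j < size p) (C (a j) - b j) * f ^+ j.
    transitivity (\sum_(j < size p) C (a j) * f ^+ j).
      rewrite /ev (@horner_coef_wide _ (size p)) ?size_map_poly ?size_poly //.
      by apply: eq_bigr => j _; rewrite coef_map /= qj.
    under [RHS]eq_bigr => j _ do rewrite mulrBl.
    rewrite sumrB [X in _ - X](_ : _ = 0) ?subr0 //.
    have : (map_poly (ev x) p).[f] / ev x p`_j0 = 0 by rewrite pf mul0r.
    rewrite (@horner_coef_wide _ (size p)) ?size_poly // mulr_suml => {2}<-.
    by apply: eq_bigr => j _; rewrite coef_map /b /=; ring.
  apply: vord_ge_sum => j _; rewrite -[1]addr0; apply: vord_geM; last exact: vord_geX.
  by rewrite -opprB; apply: vord_geN; apply: Ha.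
apply: contrapT => nv.
have [|e0 ve] := @ev_unit P f _ q q0; last first.
  by have := vord_geE e0 Hq; rewrite ve.
move=> z; have fz : f - C z != 0.
  by apply/eqP => fz; apply: nv; exists z; left.
split=> //; apply/eqP; rewrite eq_le; apply/andP; split; last first.
  by apply: vord_geE => //; apply: vord_geB => //; apply: vord_geC.
by rewrite leNgt; apply/negP => H; apply: nv; exists z; right.
Qed.

End Residue.

(** * Dimensions of the spaces L(D) *)

Section LinearFamilies.
Variables (k : closedFieldType) (X : curve k).
Implicit Types (P Q : cpoint X) (f g h : X) (D E : {freeg (cpoint X) / int}).
Local Notation C := (const X).

Definition lfree n (f : 'rV[X]_n) := forall c : 'rV[k]_n, lincomb c f = 0 -> c = 0.

(** An upper bound on [dim L(D)] that presupposes no basis. *)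
Definition dim_le D n := forall m (g : 'rV[X]_m),
  (forall j, Lspace D (g 0 j)) -> lfree g -> (m <= n)%N.

Lemma lincomb_scale n (c : 'rV[k]_n) (f : 'rV[X]_n) h :
  lincomb c (h *: f) = h * lincomb c f.
Proof. by rewrite mulr_sumr; apply: eq_bigr => j _; rewrite mxE mulrCA. Qed.

Lemma lincomb0 n (f : 'rV[X]_n) : lincomb 0 f = 0.
Proof. by apply: big1 => j _; rewrite mxE rmorph0 mul0r. Qed.

Lemma lincomb_delta n (f : 'rV[X]_n) j : lincomb (delta_mx 0 j) f = f 0 j.
Proof.
rewrite /lincomb (bigD1 j) //= mxE !eqxx rmorph1 mul1r big1 ?addr0 // => i ij.
by rewrite mxE eqxx (negPf ij) rmorph0 mul0r.
Qed.

Lemma lincomb_mul m n (M : 'M[k]_(m, n)) (f : 'rV[X]_n) (c : 'rV[k]_m) :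
  lincomb c (\row_i lincomb (row i M) f) = lincomb (c *m M) f.
Proof.
rewrite /lincomb; under eq_bigr => i _ do rewrite mxE mulr_sumr.
rewrite exchange_big; apply: eq_bigr => j _; rewrite mxE rmorph_sum mulr_suml.
by apply: eq_bigr => i _; rewrite !mxE rmorphM mulrA.
Qed.

Lemma lfree_scale n (f : 'rV[X]_n) h : h != 0 -> lfree f -> lfree (h *: f).
Proof.
by move=> h0 fr c; rewrite lincomb_scale => /eqP; rewrite mulf_eq0 (negPf h0) => /eqP/fr.
Qed.

Lemma lfree_neq0 n (f : 'rV[X]_n) : lfree f -> forall j, f 0 j != 0.
Proof.
move=> fr j; apply/eqP; rewrite -lincomb_delta => /fr/rowP/(_ j)/eqP.
by rewrite !mxE !eqxx oner_eq0.
Qed.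

Lemma Lspace0 D : Lspace D 0. Proof. by move=> P; left. Qed.

Lemma LspaceD D f g : Lspace D f -> Lspace D g -> Lspace D (f + g).
Proof. by move=> Hf Hg P; apply: vord_geD. Qed.

Lemma LspaceN D f : Lspace D f -> Lspace D (- f).
Proof. by move=> Hf P; apply: vord_geN. Qed.

Lemma LspaceZ D c f : Lspace D f -> Lspace D (C c * f).
Proof. by move=> Hf P; apply: vord_geZ. Qed.

Lemma LspaceM D E f g : Lspace D f -> Lspace E g -> Lspace (D + E) (f * g).
Proof.
by move=> Hf Hg P; rewrite coeffD opprD; apply: vord_geM.
Qed.

Lemma Lspace_const c : Lspace 0 (C c).
Proof. by move=> P; rewrite coeff_0; apply: vord_geC. Qed.

Lemma LspaceX D f (i : nat) : Lspace D f -> Lspace (D *+ i) (f ^+ i).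
Proof.
move=> Hf; elim: i => [|i IH].
  by rewrite mulr0n expr0 -(rmorph1 C); apply: Lspace_const.
by rewrite mulrS exprS; apply: LspaceM.
Qed.

Lemma Lspace_lincomb D n (c : 'rV[k]_n) (f : 'rV[X]_n) :
  (forall j, Lspace D (f 0 j)) -> Lspace D (lincomb c f).
Proof. by move=> Hf P; apply: vord_ge_sum => j _; apply/vord_geZ/Hf. Qed.

Lemma basis_lfree D n (f : 'rV[X]_n) : is_basis_L D f -> lfree f.
Proof.
case=> _ gen c Hc; have [d [_ uniq_d]] := gen _ (Lspace0 D).
by rewrite -(uniq_d c (esym Hc)) -(uniq_d 0 (esym (lincomb0 f))).
Qed.

Lemma basis_dim_le D n (f : 'rV[X]_n) : is_basis_L D f -> dim_le D n.
Proof.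
case=> _ gen m g Hg fr; rewrite leqNgt; apply/negP => nm.
have /choice[r Hr] (i : 'I_m) : exists c : 'rV[k]_n, g 0 i = lincomb c f.
  by have [c [E _]] := gen _ (Hg i); exists c.
pose M := \matrix_i r i.
have gE : g = \row_i lincomb (row i M) f.
  by apply/rowP => i; rewrite mxE rowK Hr.
have : kermx M != 0.
  rewrite -mxrank_eq0 mxrank_ker -lt0n subn_gt0.
  by apply: leq_ltn_trans (rank_leq_col M) nm.
case/rowV0Pn => c /sub_kermxP cM /eqP[].
by apply: fr; rewrite gE lincomb_mul cM lincomb0.
Qed.

(** [L(D - P)] is the kernel of a linear form on [L(D)]: the value at [P], after
    multiplication by a power of a uniformizer. *)
Lemma dim_le_addpt D P n : dim_le (D - << P >>) n -> dim_le D n.+1.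
Proof.
move=> H m f Hf fr; have [t vt] := vord_normalized P.
have t0 : t != 0 by apply/eqP => t0; move: vt; rewrite t0 vord0.
set e := coeff P D.
have te : t ^ e != 0 by rewrite expfz_neq0.
have /choice[a Ha] (j : 'I_m) : exists c, has_value P (t ^ e * f 0 j) c.
  apply: residue; rewrite -(subrr e); apply: vord_geM (Hf j P).
  by right; rewrite vordXz // vt mulr1.
pose A := \col_j a j; pose B := row_base (kermx A).
pose g : 'rV[X]_(\rank (kermx A)) := \row_i lincomb (row i B) f.
suff : (\rank (kermx A) <= n)%N.
  rewrite mxrank_ker; have := rank_leq_col A; lia.
apply: (H _ g) => [i|c]; last first.
  rewrite lincomb_mul => /fr cB; apply/eqP.
  by move/eqP: cB; rewrite mulmx_free_eq0 // row_base_free.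
have gi : Lspace D (g 0 i) by rewrite mxE; apply: Lspace_lincomb.
have [->|g0] := eqVneq (g 0 i) 0; first exact: Lspace0.
apply: Lspace_sub => //; rewrite -/e.
suff /(vord_geE (mulf_neq0 te g0)) : vord_ge P 1 (t ^ e * g 0 i).
  by rewrite vordM // vordXz // vt; lia.
apply/has_value0.
have -> : t ^ e * g 0 i = \sum_j C (B i j) * (t ^ e * f 0 j).
  by rewrite mxE mulr_sumr; apply: eq_bigr => j _; rewrite mxE mulrCA.
have -> : 0 = \sum_j B i j * a j.
  have /sub_kermxP/rowP/(_ 0) : (row i B <= kermx A)%MS.
    by apply: submx_trans (row_sub _ _) _; rewrite eq_row_base.
  by rewrite !mxE => {1}<-; apply: eq_bigr => j _; rewrite !mxE.
by apply: has_value_sum => j; apply: has_valueM => //; apply: has_valueC.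
Qed.

Lemma nonconst_transcendental f : (forall z, f != C z) -> transcendental f.
Proof.
move=> nc p p0; have [s ->] := ev_factor f p.
rewrite mulf_neq0 ?const_neq0 ?lead_coef_eq0 //.
by rewrite prodf_seq_neq0; apply/allP => z _; rewrite /= subr_eq0 nc.
Qed.

Lemma lfree_powers f n : (forall z, f != C z) -> lfree (\row_(i < n) f ^+ i).
Proof.
move=> /nonconst_transcendental ftr c Hc; apply/eqP/negPn/negP => c0.
have /ftr/eqP[] : rVpoly c != 0.
  by apply: contra c0 => /eqP E; rewrite -(rVpolyK c) E linear0.
rewrite -[RHS]Hc /ev (@horner_coef_wide _ n); last first.
  by rewrite size_map_poly size_poly.
by apply: eq_bigr => i _; rewrite coef_map /= coef_rVpoly_ord mxE.
Qed.

End LinearFamilies.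

(** * Riemann-Roch in genus 1 *)

Section GenusOne.
Variables (k : closedFieldType) (X : curve k).
Hypothesis genusX : has_genus X 1.
Variable P0 : cpoint X.
Implicit Types (P Q : cpoint X) (f g h : X) (D E : {freeg (cpoint X) / int}).
Local Notation C := (const X).

Lemma riemann D : exists n (f : 'rV[X]_n), is_basis_L D f /\ deg D <= n%:Z.
Proof. by have [n [f Hf] le] := genusX.1 D; exists n, f; split=> //; lia. Qed.

(** If [deg D < 0], the powers of [f] embed [L(- n D)], whose dimension grows
    with [n], into the finite-dimensional space [L(0)]. *)
Lemma Lspace_deg_ge0 D f : Lspace D f -> f != 0 -> 0 <= deg D.
Proof.
move=> Hf f0; rewrite leNgt; apply/negP => D0.
have [m [e [be _]]] := riemann 0.
have [n [g [bg le]]] := riemann (- D *+ m.+1).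
have /(basis_dim_le be) : forall j, Lspace 0 ((f ^+ m.+1 *: g) 0 j).
  move=> j; rewrite mxE -[0](subrr (D *+ m.+1)) -mulNrn.
  by apply: LspaceM; [apply: LspaceX | apply: bg.1].
move/(_ (lfree_scale (expf_neq0 _ f0) (basis_lfree bg))).
have dE : deg (- D *+ m.+1) = m.+1%:Z * - deg D.
  by rewrite degMn degN -mulr_natl natz.
move: le; rewrite dE; nia.
Qed.

Lemma Lspace_deg0 D f : Lspace D f -> f != 0 -> deg D = 0 ->
  forall P, vord P f = - coeff P D.
Proof.
move=> Hf f0 D0 P; apply/eqP; rewrite eq_le; apply/andP; split.
  rewrite leNgt; apply/negP => /(Lspace_sub Hf f0)/Lspace_deg_ge0/(_ f0).
  by rewrite degB1 D0; lia.
exact: vord_geE (Hf P).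
Qed.

Lemma deg_principal D f : f != 0 -> (forall P, coeff P D = vord P f) -> deg D = 0.
Proof.
move=> f0 H; have /Lspace_deg_ge0/(_ f0) : Lspace (- D) f.
  by move=> P; right; rewrite coeffN H; lia.
have f'0 : f^-1 != 0 by rewrite invr_eq0.
have /Lspace_deg_ge0/(_ f'0) : Lspace D f^-1.
  by move=> P; right; rewrite H vordV.
by rewrite degN; lia.
Qed.

(** Without such a [P] the divisor of [f] would be [- D], of non-zero degree. *)
Lemma Lspace_zero D f : Lspace D f -> f != 0 -> 0 < deg D ->
  exists P, Lspace (D - << P >>) f.
Proof.
move=> Hf f0 D0; apply: contrapT => H.
have : deg (- D) = 0; last by rewrite degN; lia.
apply: (deg_principal f0) => P; rewrite coeffN; apply/eqP; rewrite eq_le.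
apply/andP; split; first exact: vord_geE (Hf P).
by rewrite leNgt; apply/negP => /(Lspace_sub Hf f0) HP; apply: H; exists P.
Qed.

Lemma Lspace0_const f : Lspace 0 f -> exists c, f = C c.
Proof.
move=> Hf; have [|c Hc] := @residue _ _ P0 f.
  by have := Hf P0; rewrite coeff_0 oppr0.
exists c; apply/eqP; rewrite -subr_eq0; apply/negPn/negP => f0.
have Hfc : Lspace 0 (f - C c).
  by apply: LspaceD => //; apply/LspaceN/Lspace_const.
have /Lspace_deg_ge0/(_ f0) : Lspace (0 - << P0 >>) (f - C c).
  apply: Lspace_sub => //; rewrite coeff_0 oppr0.
  exact: lt_le_trans (vord_geE f0 Hc).
by rewrite degB1 deg0.
Qed.

(** The zeros of [g] as a section of [E - D] are removed one at a time; when none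
    is left, [E - D = - div g] and division by [g] maps [L(E)] into [L(D)]. *)
Lemma dim_le_shift (m : nat) D E g n : Lspace (E - D) g -> g != 0 ->
  deg (E - D) = m%:Z -> dim_le D n -> dim_le E (n + m).
Proof.
elim: m E => [|m IH] E Hg g0 Em HD; last first.
  have [|P HP] := Lspace_zero Hg g0; first by rewrite Em.
  rewrite addnS; apply: (@dim_le_addpt _ _ E P); apply: IH => //.
    by rewrite addrAC.
  by rewrite addrAC degB1 Em; lia.
rewrite addn0 => r f Hf fr.
apply: (HD _ (g^-1 *: f)); last by apply: lfree_scale; rewrite ?invr_eq0.
move=> j; rewrite mxE; have -> : D = (D - E) + E by rewrite subrK.
apply: LspaceM => // P; right.
by rewrite vordV // (Lspace_deg0 Hg g0 Em) -opprB coeffN opprK.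
Qed.

(** A non-constant function with a single simple pole would make
    [dim L(N P) > N] for all [N], contradicting the sharpness of Riemann's
    inequality: a curve with such a function has genus 0. *)
Lemma Lspace1_const P f : Lspace << P >> f -> exists c, f = C c.
Proof.
move=> Hf; apply: contrapT => nc.
have [_ [D0 [n0 [e be] D0n]]] := genusX.
(* The number of poles just large enough for [L(D - D0)] to be non-zero. *)
pose N := n0.+1; pose D := << P >> *+ N : {freeg (cpoint X) / int}.
have DN : deg D = N%:Z by rewrite degMn deg_pt -mulr_natl natz mulr1.
have D1 : deg (D - D0) = 1 by rewrite degB DN; lia.
have [[|n] [g [bg]]] := riemann (D - D0); first by rewrite D1.
rewrite D1 => _.
have : dim_le D (n0 + 1).
  apply: (dim_le_shift (bg.1 ord0) (lfree_neq0 (basis_lfree bg) _) D1).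
  exact: basis_dim_le be.
move/(_ _ (\row_(i < N.+1) f ^+ i)) => H; have {H} : (N.+1 <= n0 + 1)%N.
  apply: H; last by apply: lfree_powers => z; apply/eqP => fz; apply: nc; exists z.
  move=> i Q; rewrite mxE; apply: vord_geW (LspaceX i Hf Q).
  rewrite lerN2 !coeffMn coeff_pt; case: (P == Q); last by rewrite !mul0rn.
  by rewrite (_ : true%:Z = 1) // ler_nat -ltnS.
by rewrite /N; lia.
Qed.

Lemma dim_le_pt P : dim_le << P >> 1.
Proof.
apply: (@basis_dim_le _ _ _ _ (const_mx 1)); split=> [j Q|g Hg].
  by right; rewrite mxE vord1 coeff_pt; case: eqP.
have [c ->] := Lspace1_const Hg; exists (const_mx c).
by split=> [|d]; rewrite /lincomb big_ord1 !mxE mulr1 // => /fmorph_inj cd;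
   apply/rowP => j; rewrite ord1 mxE.
Qed.

Lemma dim_le_eq n D : deg D = n.+1%:Z -> dim_le D n.+1.
Proof.
elim: n D => [|n IH] D Dn; last first.
  by apply: (@dim_le_addpt _ _ D P0); apply: IH; rewrite degB1 Dn; lia.
have [[|m] [g [bg]]] := riemann D; first by rewrite Dn.
move=> _; have g0 := lfree_neq0 (basis_lfree bg) ord0.
have [|P HP] := Lspace_zero (bg.1 ord0) g0; first by rewrite Dn.
have := @dim_le_shift 0 << P >> D _ 1 HP g0; rewrite addn0; apply.
  by rewrite degB1 Dn.
exact: dim_le_pt.
Qed.

Lemma dim_L_deg n D : deg D = n.+1%:Z -> dim_L D n.+1.
Proof.
move=> Dn; have [m [f [bf le]]] := riemann D.
have := dim_le_eq Dn bf.1 (basis_lfree bf); rewrite Dn in le => le'.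
suff E : n.+1 = m by rewrite E; exists f.
by lia.
Qed.

Lemma Lspace_nonzero D : 0 < deg D -> exists2 f, f != 0 & Lspace D f.
Proof.
move=> D0; have [[|m] [f [bf le]]] := riemann D; first by move: le; lia.
by exists (f 0 ord0); [apply: lfree_neq0; apply: basis_lfree bf | apply: bf.1].
Qed.

(** A base point [P] would make [L(D)] equal to [L(D - P)], whereas their
    dimensions are [deg D] and [deg D - 1]. *)
Lemma basis_no_basepoint D n (f : 'rV[X]_n) P : is_basis_L D f -> 1 < deg D ->
  exists j, vord P (f 0 j) = - coeff P D.
Proof.
move=> bf D1; apply: contrapT => H.
have [n' dn] : exists n', deg (D - << P >>) = n'.+1%:Z.
  by exists `|deg D - 2|%N; rewrite degB1; lia.
have /(dim_le_eq dn)/(_ (basis_lfree bf)) : forall j, Lspace (D - << P >>) (f 0 j).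
  move=> j; apply: Lspace_sub (bf.1 j) (lfree_neq0 (basis_lfree bf) j) _.
  have := vord_geE (lfree_neq0 (basis_lfree bf) j) (bf.1 j P).
  by rewrite le_eqVlt => /orP[/eqP E|//]; case: H; exists j.
have [m dm] : exists m, deg D = m.+1%:Z by exists `|deg D - 1|%N; lia.
have [g bg] := dim_L_deg dm.
have := basis_dim_le bf bg.1 (basis_lfree bg).
by move: dn; rewrite degB1 dm; lia.
Qed.

Lemma Lspace_strict D P : 1 < deg D ->
  exists f, [/\ f != 0, Lspace D f & vord P f = - coeff P D].
Proof.
move=> D1; have [n [f [bf _]]] := riemann D.
have [j vj] := basis_no_basepoint P bf D1; exists (f 0 j); split=> //.
  exact: lfree_neq0 (basis_lfree bf) j.
exact: bf.1.
Qed.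

End GenusOne.

(** * Divisors of functions *)

Section Divisors.
Variables (k : closedFieldType) (X : curve k).
Implicit Types (P Q : cpoint X) (f g h x : X) (D E : {freeg (cpoint X) / int}).
Local Notation C := (const X).

Definition finite_poles f :=
  exists s : seq (cpoint X), forall P, P \notin s -> vord_ge P 0 f.

Lemma finite_polesC c : finite_poles (C c).
Proof. by exists [::] => P _; apply: vord_geC. Qed.

Lemma finite_polesD f g : finite_poles f -> finite_poles g -> finite_poles (f + g).
Proof.
move=> [s Hs] [t Ht]; exists (s ++ t) => P.
by rewrite mem_cat negb_or => /andP[/Hs ? /Ht ?]; apply: vord_geD.
Qed.

Lemma finite_polesM f g : finite_poles f -> finite_poles g -> finite_poles (f * g).
Proof.
move=> [s Hs] [t Ht]; exists (s ++ t) => P; rewrite -[0]addr0.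
by rewrite mem_cat negb_or => /andP[/Hs ? /Ht ?]; apply: vord_geM.
Qed.

Lemma finite_poles_ev h p : finite_poles h -> finite_poles (ev h p).
Proof.
move=> Hh; elim/poly_ind: p => [|p c IH].
  by rewrite [ev h 0]rmorph0 -(rmorph0 C); apply: finite_polesC.
have -> : ev h (p * 'X + c%:P) = ev h p * h + C c.
  by rewrite [LHS]rmorphD rmorphM /= evX evC.
by apply: finite_polesD; [apply: finite_polesM|apply: finite_polesC].
Qed.

Lemma Lspace_finite_poles D f : Lspace D f -> finite_poles f.
Proof.
move=> Hf; exists (dom D) => P /coeff_outdom DP.
by have := Hf P; rewrite DP oppr0.
Qed.

Lemma finite_poles_Lspace f : finite_poles f -> exists D, Lspace D f.
Proof.
move=> [s Hs]; exists (\sum_(P <- undup s) << `|vord P f| *g P >>) => Q.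
have -> : coeff Q (\sum_(P <- undup s) << `|vord P f| *g P >>) =
    if Q \in s then `|vord Q f| else 0.
  rewrite raddf_sum /=; case: ifP => Qs.
    rewrite (bigD1_seq Q) ?mem_undup ?undup_uniq //= coeffU eqxx mulr1.
    by rewrite big1 ?addr0 // => P /negPf PQ; rewrite coeffU PQ mulr0.
  rewrite big_seq big1 // => P; rewrite mem_undup coeffU.
  by case: eqP => [->|_ _]; rewrite ?Qs // mulr0.
case: ifP => [_|/negbT /Hs]; last by rewrite oppr0.
by right; rewrite lerNl -normrN ler_norm.
Qed.

(** If a leading term [x^d] with [x] having a pole were balanced by lower ones,
    one of the coefficients would have a pole there too. *)
Lemma finite_poles_integral d (b : 'I_d -> X) x : (forall i, finite_poles (b i)) ->
  x ^+ d + \sum_(i < d) b i * x ^+ i = 0 -> finite_poles x.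
Proof.
move=> /choice[s Hs] rel; exists (flatten [seq s i | i <- enum 'I_d]) => P HP.
have Hb i : vord_ge P 0 (b i).
  apply: Hs; apply: contra HP => Pi; apply/flattenP.
  by exists (s i) => //; apply: map_f; rewrite mem_enum.
have [->|x0] := eqVneq x 0; first by left.
right; rewrite leNgt; apply/negP => vx.
have [||/eqP[]//] := @vord_addl _ _ P (x ^+ d) (\sum_(i < d) b i * x ^+ i).
  exact: expf_neq0.
apply: vord_ge_sum => i _; rewrite -[X in vord_ge _ X]add0r; apply: vord_geM => //.
by right; rewrite !vordX //; have := ltn_ord i; nia.
Qed.

Lemma finite_poles_algebraic h f : transcendental h -> finite_poles h ->
  (forall g, finite_poles g -> finite_poles g^-1) ->
  algebraic_on h f -> finite_poles f.
Proof.
move=> htr hfin finV [p p0 pf].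
pose d := (size p).-1; have sp : size p = d.+1 by rewrite prednK ?size_poly_gt0.
have lc : ev h p`_d != 0 by apply: htr; rewrite -lead_coefE lead_coef_eq0.
apply: (@finite_poles_integral d (fun i => ev h p`_i / ev h p`_d)).
  by move=> i; apply: finite_polesM; [|apply: finV]; apply: finite_poles_ev.
have : (map_poly (ev h) p).[f] / ev h p`_d = 0 by rewrite pf mul0r.
rewrite (@horner_coef_wide _ d.+1) -?sp ?size_poly // sp mulr_suml.
rewrite big_ord_recr /= coef_map /= mulrAC divff // mul1r addrC => {2}<-.
by congr (_ + _); apply: eq_bigr => i _; rewrite coef_map /=; ring.
Qed.

Lemma ev_swap x h p :
  (map_poly (ev x) p).[h] = (map_poly (ev h) (swapXY p)).[x].
Proof.
have E (u : {poly {poly X}}) a b : (map_poly (horner_eval a) u).[b] = u.[b, a].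
  by rewrite -[in RHS]horner_evalE -horner_map /= horner_evalE hornerC.
have F a (q : {poly {poly k}}) :
    map_poly (ev a) q = map_poly (horner_eval a) (map_poly (map_poly C) q).
  by rewrite -map_poly_comp.
by rewrite !F !E -swapXY_map horner2_swapXY.
Qed.

End Divisors.

Section GenusOneDivisors.
Variables (k : closedFieldType) (X : curve k).
Hypothesis genusX : has_genus X 1.
Variable P0 : cpoint X.
Implicit Types (P Q : cpoint X) (f g h x : X) (D E : {freeg (cpoint X) / int}).
Local Notation C := (const X).

(** The zeros of [f] as a section of [D] are removed one at a time, until the
    degree is 0 and the order of [f] is determined everywhere. *)
Lemma Lspace_div D f : Lspace D f -> f != 0 -> exists E, forall P, coeff P E = vord P f.
Proof.
move=> Hf f0; have [n Dn] : exists n : nat, deg D = n.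
  by exists `|deg D|%N; have := Lspace_deg_ge0 genusX Hf f0; lia.
elim: n D Hf Dn => [|n IH] D Hf Dn.
  by exists (- D) => P; rewrite coeffN (Lspace_deg0 genusX Hf f0 Dn).
have [|P HP] := Lspace_zero genusX Hf f0; first by rewrite Dn.
by apply: IH HP _; rewrite degB1 Dn; lia.
Qed.

Lemma finite_polesV f : finite_poles f -> finite_poles f^-1.
Proof.
have [->|f0] := eqVneq f 0; first by rewrite invr0.
move=> /finite_poles_Lspace[D /Lspace_div/(_ f0)[E HE]].
exists (dom E) => P /coeff_outdom EP; right.
by rewrite vordV // -HE EP oppr0.
Qed.

Lemma exists_nonconst : exists f, finite_poles f /\ forall z, f != C z.
Proof.
have D2 : 1 < deg (<< P0 >> *+ 2 : {freeg (cpoint X) / int}).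
  by rewrite degMn deg_pt.
have [f [f0 /Lspace_finite_poles Hf vf]] := Lspace_strict genusX P0 P0 D2.
exists f; split=> // z; apply/eqP => fz.
by move: vf; rewrite fz vord_const coeffMn coeff_pt eqxx.
Qed.

(** The functions with finitely many poles form a field containing a
    transcendental function, over which everything is algebraic. *)
Lemma all_finite_poles f : finite_poles f.
Proof.
have [h [hfin /nonconst_transcendental htr]] := exists_nonconst.
have [x xtr alg] := curve_algebraic X.
have xfin : finite_poles x.
  apply: (finite_poles_algebraic htr hfin finite_polesV).
  have [p p0 ph] := alg h; exists (swapXY p); first by rewrite swapXY_eq0.
  by rewrite -ev_swap.
exact: finite_poles_algebraic xtr xfin finite_polesV (alg f).
Qed.

Lemma div_exists f : f != 0 -> exists D, forall P, coeff P D = vord P f.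
Proof.
by move=> f0; have [D /Lspace_div/(_ f0)] := finite_poles_Lspace (all_finite_poles f).
Qed.

Lemma nonconst_pole f : (forall z, f != C z) -> exists P, f != 0 /\ vord P f < 0.
Proof.
move=> nc; have f0 : f != 0 by have := nc 0; rewrite rmorph0.
apply: contrapT => H; have [|c /eqP] := Lspace0_const genusX P0 (f := f).
  move=> P; rewrite coeff_0 oppr0; right; rewrite leNgt; apply/negP => vf.
  by apply: H; exists P.
exact/negP.
Qed.

Lemma nonconst_value f c : (forall z, f != C z) -> exists P, has_value P f c.
Proof.
move=> nc; have fc0 : f - C c != 0 by rewrite subr_eq0.
have [|P [_ vP]] := @nonconst_pole (f - C c)^-1.
  move=> z; apply/eqP => /(congr1 GRing.inv)/eqP; rewrite invrK -fmorphV subr_eq.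
  by rewrite -rmorphD; apply/negP.
by exists P; right; move: vP; rewrite vordV //; lia.
Qed.

Lemma closed_field_infinite (s : seq k) : exists c, c \notin s.
Proof.
pose p := \prod_(z <- s) ('X - z%:P) * 'X + 1.
have sp : size (\prod_(z <- s) ('X - z%:P) * 'X) = (size s).+2.
  by rewrite size_mulX ?monic_neq0 ?monic_prod_XsubC // size_prod_XsubC.
have /closed_rootP[c /eqP pc] : size p != 1 by rewrite size_polyDl sp ?size_poly1.
exists c; apply/negP => cs; move/eqP: pc; rewrite !hornerE.
have /eqP -> : root (\prod_(z <- s) ('X - z%:P)) c by rewrite root_prod_XsubC.
by rewrite mul0r add0r oner_eq0.
Qed.

Lemma points_infinite (s : seq (cpoint X)) : exists P, P \notin s.
Proof.
have [h [_ nc]] := exists_nonconst.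
pose a P := xget 0 [set c | has_value P h c]%classic.
have [c cs] := closed_field_infinite [seq a P | P <- s].
have [P Pc] := nonconst_value c nc; exists P; apply: contra cs => Ps.
apply/mapP; exists P => //; rewrite /a; case: xgetP => [c' _|/(_ c)//].
exact: has_value_inj Pc.
Qed.

Lemma notin_cons (s : seq (cpoint X)) P R : P \notin R :: s -> P <> R /\ P \notin s.
Proof.
move=> H; split=> [E|]; first by move: H; rewrite E mem_head.
by apply: contra H => Hs; rewrite in_cons Hs orbT.
Qed.

Lemma almost_all_zero (s : seq (cpoint X)) f :
  (forall P, P \notin s -> vord_ge P 1 f) -> f = 0.
Proof.
move=> H; apply/eqP/negPn/negP => f0; have [D HD] := div_exists f0.
have [P] := points_infinite (s ++ dom D).
rewrite mem_cat negb_or => /andP[/H/(vord_geE f0) Pf /coeff_outdom].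
by rewrite HD => vP; move: Pf; rewrite vP.
Qed.

Lemma eq_from_values f g :
  (forall P c, has_value P f c -> has_value P g c) -> f = g.
Proof.
move=> H; have [s Hs] := all_finite_poles f.
apply/eqP; rewrite -subr_eq0; apply/eqP/(@almost_all_zero s) => P /Hs/residue[c fc].
by apply/has_value0; rewrite -(subrr c); apply: has_valueB; last exact: H.
Qed.

(** * The divisor class group *)

Lemma divclD D E : divcl (D + E) = divcl D + divcl E.
Proof. exact: raddfD. Qed.

Lemma divclB D E : divcl (D - E) = divcl D - divcl E.
Proof. exact: raddfB. Qed.

Lemma divcl_surj (delta : Pic X) : exists D, divcl D = delta.
Proof. by exists (repr (delta : Quotient.quot (@principal k X))); apply: reprK. Qed.

Lemma divclP D E : divcl D = divcl E <->
  exists2 f, f != 0 & forall P, coeff P (D - E) = vord P f.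
Proof.
split=> [/eqP|H].
  by rewrite /divcl -Quotient.idealrBE => /asboolP.
by apply/eqP; rewrite /divcl -Quotient.idealrBE; apply/asboolP.
Qed.

Lemma divcl_deg D E : divcl D = divcl E -> deg D = deg E.
Proof.
move=> /divclP[f f0 Hf]; apply/eqP; rewrite -subr_eq0 -degB.
by rewrite (deg_principal genusX f0 Hf).
Qed.

(** A function with divisor [P - Q] has a single simple pole, so it is constant. *)
Lemma pt_inj P Q : divcl << P >> = divcl << Q >> -> P = Q.
Proof.
move=> /divclP[f f0 Hf]; have [|c fc] := @Lspace1_const _ _ genusX Q f.
  move=> R; right; rewrite -Hf coeffB1 !coeff_pt; case: (P == R) => /=; lia.
have := Hf P; rewrite fc vord_const coeffB1 coeff_pt eqxx.
by case: eqP => [->|_] //=.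
Qed.

(** A non-zero section of [L(D)] has a single zero. *)
Lemma deg1_pt D : deg D = 1 -> exists Q, divcl << Q >> = divcl D.
Proof.
move=> D1; have [|f f0 Hf] := Lspace_nonzero genusX (D := D); first by rewrite D1.
have [|Q HQ] := Lspace_zero genusX Hf f0; first by rewrite D1.
exists Q; apply/divclP; exists f => // P.
by rewrite (Lspace_deg0 genusX HQ f0) ?degB1 ?D1 // -coeffN opprB.
Qed.

Lemma translateE P (delta : Pic X) : in_Pic_deg 0 delta ->
  divcl << translate P delta >> = divcl << P >> + delta.
Proof.
move=> [D <- D0]; rewrite /translate; case: xgetP => [Q _ //|H].
have [|Q HQ] := @deg1_pt (<< P >> + D); first by rewrite degD D0 deg_pt.
by case: (H Q); rewrite /= HQ divclD.
Qed.

Lemma two_torsion_deg0 (delta : Pic X) : delta *+ 2 = 0 -> in_Pic_deg 0 delta.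
Proof.
have [D <-] := divcl_surj delta; rewrite mulr2n -divclD => D2.
exists D => //; have : divcl (D + D) = divcl 0 by rewrite D2 /divcl raddf0.
by move/divcl_deg; rewrite degD deg0; lia.
Qed.

End GenusOneDivisors.

(** * Quadratic extensions of k(x) *)

Section RationalSubfield.
Variables (k : closedFieldType) (X : curve k) (x : X).
Hypothesis xtr : transcendental x.
Local Notation C := (const X).

Definition ratfun (f : X) := exists p q : {poly k}, q != 0 /\ f = ev x p / ev x q.

Lemma ratfun_ev p : ratfun (ev x p).
Proof. by exists p, 1; rewrite oner_neq0 [ev x 1]rmorph1 divr1. Qed.

Lemma ratfunC c : ratfun (C c).
Proof. by rewrite -(evC x); apply: ratfun_ev. Qed.

Lemma ratfunD f g : ratfun f -> ratfun g -> ratfun (f + g).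
Proof.
move=> [p [q [q0 ->]]] [r [s [s0 ->]]]; exists (p * s + r * q), (q * s).
have [eq es] : ev x q != 0 /\ ev x s != 0 by split; apply: xtr.
rewrite mulf_neq0 // [ev x (_ + _)]rmorphD ![ev x (_ * _)]rmorphM.
by split=> //; field; rewrite eq es.
Qed.

Lemma ratfunM f g : ratfun f -> ratfun g -> ratfun (f * g).
Proof.
move=> [p [q [q0 ->]]] [r [s [s0 ->]]]; exists (p * r), (q * s).
have [eq es] : ev x q != 0 /\ ev x s != 0 by split; apply: xtr.
by rewrite mulf_neq0 // ![ev x (_ * _)]rmorphM; split=> //; field; rewrite eq es.
Qed.

Lemma ratfunN f : ratfun f -> ratfun (- f).
Proof. by rewrite -mulN1r -(rmorphN1 C); apply/ratfunM/ratfunC. Qed.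

Lemma ratfunB f g : ratfun f -> ratfun g -> ratfun (f - g).
Proof. by move=> Hf /ratfunN; apply: ratfunD. Qed.

Lemma ratfunV f : ratfun f -> ratfun f^-1.
Proof.
move=> [p [q [q0 ->]]]; have [->|p0] := eqVneq p 0.
  by rewrite [ev x 0]rmorph0 mul0r invr0 -(rmorph0 C); apply: ratfunC.
by exists q, p; rewrite invf_div.
Qed.

Lemma ratfun_root f r0 r1 : r1 != 0 -> ev x r0 + ev x r1 * f = 0 -> ratfun f.
Proof.
move=> r10 E; have e1 := xtr r10.
have -> : f = - (ev x r0 / ev x r1).
  by apply: (mulfI e1); rewrite mulrN mulrC mulrCA divff // mulr1; apply/eqP;
     rewrite -addr_eq0 addrC mulrC E.
by apply: ratfunN; apply: ratfunM; [|apply: ratfunV]; apply: ratfun_ev.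
Qed.

Variable y : X.
Hypothesis y_irr : ~ ratfun y.
Hypothesis y2 : ratfun (y ^+ 2).
Hypothesis gen : forall f, exists a b, [/\ ratfun a, ratfun b & f = a + b * y].

Lemma quadratic_coord_inj a b a' b' : ratfun a -> ratfun b -> ratfun a' -> ratfun b' ->
  a + b * y = a' + b' * y -> a = a' /\ b = b'.
Proof.
move=> Ha Hb Ha' Hb' E.
have {}E : (b - b') * y = a' - a.
  by apply/eqP; rewrite eq_sym -subr_eq0; apply/eqP; move: E => /eqP;
     rewrite -subr_eq0 => /eqP E; rewrite -[RHS]oppr0 -E; ring.
have bb : b - b' = 0.
  apply/eqP/negPn/negP => b0; apply: y_irr.
  have -> : y = (a' - a) * (b - b')^-1 by rewrite -E mulrAC divff // mul1r.
  by apply: ratfunM; [|apply: ratfunV]; apply: ratfunB.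
move: E; rewrite bb mul0r => /esym/eqP; rewrite subr_eq0 => /eqP ->.
by split=> //; apply/eqP; rewrite -subr_eq0 bb.
Qed.

Lemma quadratic_conjugation : exists s : {rmorphism X -> X},
  forall a b, ratfun a -> ratfun b -> s (a + b * y) = a - b * y.
Proof.
have /choice[ab Hab] f : exists ab : X * X,
    [/\ ratfun ab.1, ratfun ab.2 & f = ab.1 + ab.2 * y].
  by have [a [b []]] := gen f; exists (a, b).
pose s f := (ab f).1 - (ab f).2 * y.
have sE a b : ratfun a -> ratfun b -> s (a + b * y) = a - b * y.
  move=> Ha Hb; rewrite /s; have [Ha' Hb' E] := Hab (a + b * y).
  by have [<- <-] := quadratic_coord_inj Ha Hb Ha' Hb' E.
have sB : zmod_morphism s.
  move=> f g; have [Ha Hb ->] := Hab f; have [Hc Hd ->] := Hab g.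
  move: (ab f) (ab g) Ha Hb Hc Hd => [a b] [c d] /= Ha Hb Hc Hd.
  have -> : a + b * y - (c + d * y) = (a - c) + (b - d) * y by ring.
  by rewrite !sE //; [ring | apply: ratfunB | apply: ratfunB].
have sM : monoid_morphism s.
  split=> [|f g].
    have R1 : ratfun 1 by rewrite -(rmorph1 C); apply: ratfunC.
    have R0 : ratfun 0 by rewrite -(rmorph0 C); apply: ratfunC.
    by have := sE 1 0 R1 R0; rewrite mul0r addr0 subr0.
  have [Ha Hb ->] := Hab f; have [Hc Hd ->] := Hab g.
  move: (ab f) (ab g) Ha Hb Hc Hd => [a b] [c d] /= Ha Hb Hc Hd.
  rewrite !sE //.
  have -> : (a + b * y) * (c + d * y) = (a * c + b * d * y ^+ 2) + (a * d + b * c) * y.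
    by ring.
  rewrite sE; first by ring.
    by apply: ratfunD; [|apply: ratfunM => //]; apply: ratfunM.
  by apply: ratfunD; apply: ratfunM.
pose sA := GRing.isZmodMorphism.Build X X s sB.
pose sR := GRing.isMonoidMorphism.Build X X s sM.
by exists (HB.pack_for {rmorphism X -> X} s sA sR).
Qed.

End RationalSubfield.

Section Involution.
Variables (k : closedFieldType) (X : curve k).
Hypothesis genusX : has_genus X 1.
Hypothesis two_neq0 : 2%:R != 0 :> k.
Variable P0 : cpoint X.
Implicit Types (P Q R : cpoint X) (f g h x : X) (D E : {freeg (cpoint X) / int}).
Local Notation C := (const X).

Lemma lincomb_row_mx m n (c : 'rV[k]_(m + n)) (f : 'rV[X]_m) (g : 'rV[X]_n) :
  lincomb c (row_mx f g) = lincomb (lsubmx c) f + lincomb (rsubmx c) g.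
Proof.
rewrite /lincomb big_split_ord /=.
by congr (_ + _); apply: eq_bigr => i _; rewrite ?row_mxEl ?row_mxEr !mxE.
Qed.

Lemma lincomb_powers n (c : 'rV[k]_n) x h :
  lincomb c (h *: \row_(i < n) x ^+ i) = h * ev x (rVpoly c).
Proof.
rewrite lincomb_scale /ev (@horner_coef_wide _ n); last by rewrite size_map_poly size_poly.
by congr (_ * _); apply: eq_bigr => i _; rewrite coef_map /= coef_rVpoly_ord mxE.
Qed.

Lemma rVpoly_eq0 n (c : 'rV[k]_n) : rVpoly c = 0 -> c = 0.
Proof. by move=> E; rewrite -(rVpolyK c) E linear0. Qed.

(** A function with two poles generates a subfield of index at most 2: otherwise
    the [3 (n + 1)] products [x^i], [x^i f], [x^i g], all lying in [L(E + n D)],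
    would outnumber its dimension [deg E + 2 n]. *)
Lemma degree2_dependent D x f g : deg D = 2 -> Lspace D x -> Lspace D 1 ->
  exists r0 r1 r2, [/\ r0 = 0 -> r1 = 0 -> r2 = 0 -> False &
    ev x r0 + ev x r1 * f + ev x r2 * g = 0].
Proof.
move=> D2 Hx H1.
have pos h : exists E, Lspace E h /\ Lspace E 1.
  have [E HE] := finite_poles_Lspace (all_finite_poles genusX P0 h).
  exists (fgpos E); split=> P; last first.
    by right; rewrite vord1 coeff_fgposE oppr_le0 le_max lexx.
  by apply: vord_geW (HE P); rewrite coeff_fgposE lerN2 le_max lexx orbT.
have [E1 [Hf Hf1]] := pos f; have [E2 [Hg Hg1]] := pos g.
pose E := E1 + E2.
have HE1 : Lspace E 1 by rewrite -[1]mulr1; apply: LspaceM.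
have HEf : Lspace E f by rewrite -[f]mulr1; apply: LspaceM.
have HEg : Lspace E g by rewrite -[g]mul1r; apply: LspaceM.
have [e Ee] : exists e : nat, deg E = e.
  by exists `|deg E|%N; have := Lspace_deg_ge0 genusX HE1 (oner_neq0 _); lia.
(* With this [n], [3 (n + 1) = 3 e + 6] exceeds [e + 2 n = 3 e + 2]. *)
pose n := e.+1; pose N := n.+1; pose w : 'rV[X]_N := \row_(i < N) x ^+ i.
pose v := row_mx (row_mx (1 *: w) (f *: w)) (g *: w).
have Hw h : Lspace E h -> forall i, Lspace (E + D *+ n) ((h *: w) 0 i).
  move=> Hh i; rewrite !mxE; apply: LspaceM => //.
  rewrite -[x ^+ i]mulr1 -(expr1n _ (n - i)).
  have -> : D *+ n = D *+ i + D *+ (n - i).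
    by rewrite -mulrnDr subnKC // -ltnS.
  by apply: LspaceM; apply: LspaceX.
have Hv j : Lspace (E + D *+ n) (v 0 j).
  rewrite !mxE; case: (split j) => j'; last exact: Hw.
  by rewrite !mxE; case: (split j') => j''; apply: Hw.
have dE : deg (E + D *+ n) = (3 * e + 1).+1%:Z.
  by rewrite degD degMn D2 Ee /n -mulr_natl natz; lia.
have : exists c, lincomb c v = 0 /\ c <> 0.
  apply: contrapT => H; have : lfree v; last first.
    by move/(dim_le_eq genusX P0 dE Hv); rewrite /N /n; lia.
  by move=> c Hc; apply: contrapT => c0; apply: H; exists c.
case=> c [Hc c0].
exists (rVpoly (lsubmx (lsubmx c))), (rVpoly (rsubmx (lsubmx c))), (rVpoly (rsubmx c)).
split.
  move=> /rVpoly_eq0 a0 /rVpoly_eq0 b0 /rVpoly_eq0 d0; apply: c0.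
  by rewrite -[c]hsubmxK -[lsubmx c]hsubmxK a0 b0 d0 !row_mx0.
by move: Hc; rewrite /v !lincomb_row_mx !lincomb_powers mul1r => <-; ring.
Qed.

(** Completing the square puts a generator of [X] over [k(x)] in this form. *)
Lemma ratfun_quadratic D x : deg D = 2 -> Lspace D x -> Lspace D 1 ->
  transcendental x -> (exists y, ~ ratfun x y) ->
  exists y, [/\ ~ ratfun x y, ratfun x (y ^+ 2) &
    forall f, exists a b, [/\ ratfun x a, ratfun x b & f = a + b * y]].
Proof.
move=> D2 Hx H1 xtr [z Hz].
have gen f : exists a b, [/\ ratfun x a, ratfun x b & f = a + b * z].
  have [r0 [r1 [r2 [nz E]]]] := degree2_dependent z f D2 Hx H1.
  have [r20|r20] := eqVneq r2 0.
    move: E; rewrite r20 [ev x 0]rmorph0 mul0r addr0 => E.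
    have [r10|r10] := eqVneq r1 0; last by case: Hz; apply: ratfun_root E.
    move: E; rewrite r10 [ev x 0]rmorph0 mul0r addr0 => E.
    case: nz => //; apply/eqP/negPn/negP => /xtr; by rewrite E eqxx.
  have e2 := xtr _ r20; exists (- (ev x r0 / ev x r2)), (- (ev x r1 / ev x r2)).
  have R p : ratfun x (- (ev x p / ev x r2)).
    apply: (ratfunN xtr); apply: (ratfunM xtr); first exact: ratfun_ev.
    by apply: ratfunV; apply: ratfun_ev.
  split=> //; apply: (mulfI e2); apply/eqP; rewrite -subr_eq0 -[X in _ == X]E; apply/eqP.
  by field.
have C2 : C 2%:R != 0 by rewrite const_neq0.
have [a [b [Ha Hb zz]]] := gen (z ^+ 2).
have Hb2 : ratfun x (b / C 2%:R) by apply: (ratfunM xtr) => //; apply: ratfunV; apply: ratfunC.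
exists (z - b / C 2%:R); split.
- by move=> H; apply: Hz; rewrite -(subrK (b / C 2%:R) z); apply: (ratfunD xtr).
- have -> : (z - b / C 2%:R) ^+ 2 = a + (b / C 2%:R) ^+ 2.
    have -> : (z - b / C 2%:R) ^+ 2 = z ^+ 2 - b * z + (b / C 2%:R) ^+ 2.
      by rewrite rmorph_nat; field; rewrite -(rmorph_nat C).
    by rewrite zz addrK.
  by apply: (ratfunD xtr) => //; rewrite expr2; apply: (ratfunM xtr).
move=> f; have [c [d [Hc Hd ->]]] := gen f.
exists (c + d * (b / C 2%:R)), d; split=> //; last by ring.
by apply: (ratfunD xtr) => //; apply: (ratfunM xtr).
Qed.

End Involution.

(** * Reflections of a curve of genus 1 *)

Section Automorphisms.
Variables (k : closedFieldType) (X : curve k).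
Local Notation C := (const X).

Lemma point_pullback (s : {rmorphism X -> X}) (s' : X -> X) :
  (forall c, s (C c) = C c) -> cancel s' s ->
  forall P : cpoint X, exists Q, forall f, vord Q f = vord P (s f).
Proof.
move=> sC sK P; pose v f := vord P (s f).
have v0 : v 0 = 0 by rewrite /v rmorph0 vord0.
have vM f g : f != 0 -> g != 0 -> v (f * g) = v f + v g.
  by move=> f0 g0; rewrite /v rmorphM vordM ?fmorph_eq0.
have vD f g : f != 0 -> g != 0 -> f + g != 0 -> Num.min (v f) (v g) <= v (f + g).
  by move=> f0 g0 fg; rewrite /v rmorphD; apply: vordD; rewrite -?rmorphD fmorph_eq0.
have vC c : v (C c) = 0 by rewrite /v sC vord_const.
have v1 : exists t, v t = 1.
  by have [t vt] := vord_normalized P; exists (s' t); rewrite /v sK.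
by exists (Point v0 vM vD vC v1).
Qed.

Lemma vord_ge_auto (s : {rmorphism X -> X}) (P Q : cpoint X) :
  (forall f, vord P (s f) = vord Q f) ->
  forall n f, vord_ge P n (s f) <-> vord_ge Q n f.
Proof.
move=> H n f; split=> [[/eqP|]|[->|]].
- by rewrite fmorph_eq0 => /eqP; left.
- by rewrite H; right.
- by rewrite rmorph0; left.
- by rewrite -H; right.
Qed.

Lemma has_value_auto (s : {rmorphism X -> X}) (P Q : cpoint X) :
  (forall c, s (C c) = C c) -> (forall f, vord P (s f) = vord Q f) ->
  forall f c, has_value P (s f) c <-> has_value Q f c.
Proof.
by move=> sC H f c; rewrite /has_value -[C c in X in X <-> _]sC -rmorphB; apply: vord_ge_auto.
Qed.

End Automorphisms.

Section Involution.
Variables (k : closedFieldType) (X : curve k).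
Hypothesis genusX : has_genus X 1.
Hypothesis two_neq0 : 2%:R != 0 :> k.
Implicit Types (P Q R : cpoint X) (f g h x y : X) (D E : {freeg (cpoint X) / int}).
Local Notation C := (const X).

(** [Q] is the reflection [s - P] of [P], where [s] is the class of [A + B]. *)
Definition conj_pt (A B P Q : cpoint X) :=
  divcl (<< P >> + << Q >>) = divcl (<< A >> + << B >>).

Lemma conj_ptC A B P Q : conj_pt A B P Q -> conj_pt A B Q P.
Proof. by rewrite /conj_pt addrC. Qed.

Lemma conj_pt_inj A B P Q Q' : conj_pt A B P Q -> conj_pt A B P Q' -> Q = Q'.
Proof.
by rewrite /conj_pt !divclD => <- /addrI/esym /(pt_inj genusX).
Qed.

Lemma conj_pt_ex A B P : exists Q, conj_pt A B P Q.
Proof.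
have [|Q HQ] := @deg1_pt _ _ genusX (<< A >> + << B >> - << P >>).
  by rewrite degB1 degD !deg_pt.
by exists Q; rewrite /conj_pt divclD HQ -divclD addrC subrK.
Qed.

Lemma conj_pt_eq A B P P' R R' : conj_pt A B P P' -> conj_pt A B R R' ->
  (R == P) = (R' == P').
Proof.
move=> HP HR; apply/eqP/eqP => E.
  by rewrite E in HR; apply: conj_pt_inj HR HP.
by rewrite E in HR; apply: conj_pt_inj (conj_ptC HR) (conj_ptC HP).
Qed.

Section Construction.
Variables (A B : cpoint X) (x : X).
Hypothesis Hx : Lspace (<< A >> + << B >>) x.
Hypothesis xnc : forall z, x != C z.

Let xtr : transcendental x := nonconst_transcendental xnc.
Let Deg2 : deg (<< A >> + << B >> : {freeg (cpoint X) / int}) = 2.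
Proof. by rewrite degD !deg_pt. Qed.

Lemma Lspace_AB1 : Lspace (<< A >> + << B >>) (1 : X).
Proof. by move=> P; right; rewrite vord1 coeffD !coeff_pt; do !case: eqP. Qed.

Lemma fiber_div c : exists R R', conj_pt A B R R' /\ forall P,
  vord P (x - C c) = (R == P)%:Z + (R' == P)%:Z - (A == P)%:Z - (B == P)%:Z.
Proof.
have f0 : x - C c != 0 by rewrite subr_eq0.
have Hf : Lspace (<< A >> + << B >>) (x - C c).
  by apply: LspaceD => //; apply: LspaceN; rewrite -[C c]mulr1; apply/LspaceZ/Lspace_AB1.
have [|R HR] := Lspace_zero genusX Hf f0; first by rewrite Deg2.
have [|R' HR'] := Lspace_zero genusX HR f0; first by rewrite degB1 Deg2.
have D0 : deg (<< A >> + << B >> - << R >> - << R' >>) = 0 :> int.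
  by rewrite !degB1 Deg2.
have vf P : vord P (x - C c) = (R == P)%:Z + (R' == P)%:Z - (A == P)%:Z - (B == P)%:Z.
  rewrite (Lspace_deg0 genusX HR' f0 D0) !coeffB1 coeffD !coeff_pt; lia.
exists R, R'; split=> //; apply/divclP; exists (x - C c) => // P.
by rewrite vf coeffB !coeffD !coeff_pt; lia.
Qed.

Lemma ratfun_vord_conj f P P' : ratfun x f -> conj_pt A B P P' ->
  vord P f = vord P' f /\ (P = P' -> exists m, vord P f = m * 2).
Proof.
move=> [p [q [q0 ->]]] HP.
have AB : conj_pt A B A B by [].
have lin c : vord P (x - C c) = vord P' (x - C c) /\
    (P = P' -> exists m, vord P (x - C c) = m * 2).
  have [R [R' [HR vR]]] := fiber_div c; rewrite !vR.
  have e1 := conj_pt_eq HP HR; have e2 := conj_pt_eq HP (conj_ptC HR).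
  have e3 := conj_pt_eq HP AB; have e4 := conj_pt_eq HP (conj_ptC AB).
  split=> [|E]; first by rewrite e1 e2 e3 e4; lia.
  exists ((R == P)%:Z - (A == P)%:Z).
  by rewrite e2 e4 -E; lia.
have poly_case r : r != 0 -> vord P (ev x r) = vord P' (ev x r) /\
    (P = P' -> exists m, vord P (ev x r) = m * 2).
  move=> r0; have [s ->] := ev_factor x r.
  rewrite !vordZ ?lead_coef_eq0 //.
  have : \prod_(z <- s) (x - C z) != 0 /\
     (vord P (\prod_(z <- s) (x - C z)) = vord P' (\prod_(z <- s) (x - C z)) /\
      (P = P' -> exists m, vord P (\prod_(z <- s) (x - C z)) = m * 2)).
    elim/big_ind: _ => [|g h [g0 [vg eg]] [h0 [vh eh]]|z _].
    - by rewrite oner_neq0 !vord1; split=> //; split=> // _; exists 0.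
    - rewrite mulf_neq0 // !vordM // vg vh; split=> //; split=> // E.
      move: (eg E) (eh E) => [a Ha] [b Hb]; exists (a + b).
      by rewrite mulrDl -Ha -Hb vg vh.
    - by rewrite subr_eq0; split.
  by case.
have [->|p0] := eqVneq p 0.
  by rewrite [ev x 0]rmorph0 mul0r !vord0; split=> // _; exists 0.
have [vp mp] := poly_case p p0; have [vq mq] := poly_case q q0.
rewrite !vord_div ?xtr // vp vq; split=> // E; rewrite -vp -vq.
have [a ->] := mp E; have [b ->] := mq E; exists (a - b); lia.
Qed.

(** The fibres of [x] have two points, so [x] does not generate [X]: an element
    of [k(x)] cannot separate [P] from its reflection, nor have order 1 at a
    fixed point of the reflection. *)
Lemma not_ratfun : exists y, ~ ratfun x y.
Proof.
have [B' HB] := conj_pt_ex A B A; apply: contrapT => H.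
have {}H f : ratfun x f by apply: contrapT => nf; apply: H; exists f.
have AB' : A = B' by apply: cpoint_eq => f; case: (ratfun_vord_conj (H f) HB).
have [t vt] := vord_normalized A.
have [_ /(_ AB')[m]] := ratfun_vord_conj (H t) HB; rewrite vt; lia.
Qed.

Lemma involution_of_pencil : exists s : {rmorphism X -> X},
  [/\ forall c, s (C c) = C c, forall f, s (s f) = f,
      exists2 y, y != 0 & s y = - y &
      forall P Q, conj_pt A B P Q -> forall f, vord P (s f) = vord Q f].
Proof.
have [y [y_irr y2 gen]] := ratfun_quadratic genusX two_neq0 A Deg2 Hx Lspace_AB1 xtr not_ratfun.
have [s sE] := quadratic_conjugation xtr y_irr y2 gen.
have R0 : ratfun x 0 by rewrite -(rmorph0 C); apply: ratfunC.
have R1 : ratfun x 1 by rewrite -(rmorph1 C); apply: ratfunC.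
have s_rat f : ratfun x f -> s f = f.
  by move=> Hf; have := sE _ _ Hf R0; rewrite mul0r addr0 subr0.
have sy : s y = - y by have := sE _ _ R0 R1; rewrite mul1r !add0r.
have sC c : s (C c) = C c by apply/s_rat/ratfunC.
have sK f : s (s f) = f.
  have [a [b [Ha Hb ->]]] := gen f.
  by rewrite !rmorphD !rmorphM !(s_rat a) // !(s_rat b) // sy rmorphN sy opprK.
have norm f : ratfun x (f * s f).
  have [a [b [Ha Hb ->]]] := gen f; rewrite sE //.
  have -> : (a + b * y) * (a - b * y) = a * a - b * b * y ^+ 2 by ring.
  by apply: (ratfunB xtr); apply: (ratfunM xtr) => //; apply: (ratfunM xtr).
exists s; split=> //.
  by exists y => //; apply/eqP => y0; apply: y_irr; rewrite y0.
(* [s] maps each fibre of [x] to itself. *)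
have fib P P' : conj_pt A B P P' -> exists2 Q, Q = P \/ Q = P' &
    forall f, vord P (s f) = vord Q f.
  move=> HP; have [Q HQ] := point_pullback sC sK P; exists Q; last by move=> f; rewrite HQ.
  have vQ c : vord Q (x - C c) = vord P (x - C c).
    rewrite HQ s_rat //.
    have -> : x - C c = ev x ('X - c%:P) by rewrite [RHS]rmorphB /= evX evC.
    exact: ratfun_ev.
  have mem R R' : conj_pt A B R R' -> P = R \/ P = R' -> Q = R \/ Q = R' ->
      Q = P \/ Q = P'.
    move=> HR [E|E]; rewrite -{}E in HR *.
      by have -> := conj_pt_inj HR HP.
    by rewrite -(conj_pt_inj HP (conj_ptC HR)) => -[]; [right|left].
  have [vx|vx] := ltP (vord P x) 0.
    have := vQ 0; have [R [R' [HR vR]]] := fiber_div 0; move=> vQ0.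
    have vP0 : vord P (x - C 0) < 0 by rewrite rmorph0 subr0.
    have vQ1 : vord Q (x - C 0) < 0 by rewrite vQ0.
    apply: (mem A B) => //.
      move: vP0; rewrite vR; case: (A =P P) => [->|_]; first by left.
      by case: (B =P P) => [->|_]; first (by right); lia.
    move: vQ1; rewrite vR; case: (A =P Q) => [->|_]; first by left.
    by case: (B =P Q) => [->|_]; first (by right); lia.
  have [|c vc] := @residue _ _ P x; first by right.
  have xc0 : x - C c != 0 by rewrite subr_eq0.
  have {}vc := vord_geE xc0 vc; have := vQ c.
  have [R [R' [HR vR]]] := fiber_div c => vQc.
  apply: (mem R R') => //.
    move: vc; rewrite vR; case: (R =P P) => [->|_]; first by left.
    by case: (R' =P P) => [->|_]; first (by right); lia.
  move: vc; rewrite -vQc vR; case: (R =P Q) => [->|_]; first by left.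
  by case: (R' =P Q) => [->|_]; first (by right); lia.
move=> P P' HP; have [Q [->|->] HQ //] := fib P P' HP.
(* [s] could only fix both points of a fibre, but then the norm [f s(f)], an
   element of [k(x)], would separate them. *)
have [<- //|PP'] := pselect (P = P').
case: PP'; apply: cpoint_eq => f; have [S [->|->] HS] := fib P' P (conj_ptC HP).
  have [->|f0] := eqVneq f 0; first by rewrite !vord0.
  have [E _] := ratfun_vord_conj (norm f) HP.
  have sf0 : s f != 0 by rewrite fmorph_eq0.
  by move: E; rewrite !vordM // HQ HS; lia.
by rewrite -[in RHS](sK f) HS HQ.
Qed.

End Construction.
End Involution.

(** * Parity at the fixed points of a reflection, and translations *)

Section Reflections.
Variables (k : closedFieldType) (X : curve k).
Hypothesis genusX : has_genus X 1.
Hypothesis two_neq0 : 2%:R != 0 :> k.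
Implicit Types (P Q R q : cpoint X) (f g h x y : X) (D E : {freeg (cpoint X) / int}).
Local Notation C := (const X).

Definition reflection (A B : cpoint X) (s : {rmorphism X -> X}) :=
  [/\ forall c, s (C c) = C c, forall f, s (s f) = f,
      exists2 y, y != 0 & s y = - y &
      forall P Q, conj_pt A B P Q -> forall f, vord P (s f) = vord Q f].

Lemma reflection_ex A B : exists s, reflection A B s.
Proof.
have D2 : 1 < deg (<< A >> + << B >> : {freeg (cpoint X) / int}).
  by rewrite degD !deg_pt.
have [x [x0 Hx vx]] := Lspace_strict genusX A A D2.
apply: (involution_of_pencil genusX two_neq0 Hx) => z; apply/eqP => xz.
by move: vx; rewrite xz vord_const coeffD !coeff_pt eqxx; case: eqP.
Qed.

Lemma opp_neq f : f != 0 -> - f <> f.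
Proof.
move=> f0 /eqP; rewrite eq_sym -subr_eq0 opprK -mulr2n -mulr_natr mulf_eq0 (negPf f0) /=.
by rewrite -(rmorph_nat C) fmorph_eq0 (negPf two_neq0).
Qed.

Lemma int_parity (n : int) : (exists m, n = m * 2) \/ (exists m, n = m * 2 + 1).
Proof.
have : n = (n %/ 2)%Z * 2 \/ n = (n %/ 2)%Z * 2 + 1 by lia.
by case=> E; [left|right]; exists (n %/ 2)%Z.
Qed.

Section Parity.
Variables (A B q : cpoint X) (s : {rmorphism X -> X}).
Hypothesis Hs : reflection A B s.
Hypothesis Hq : conj_pt A B q q.

(** At a fixed point an odd function has the value [c = - c] if it is regular;
    multiplying by powers of [t s(t)], an even function of order 2, every even
    order is reduced to 0. *)
Lemma odd_order f : f != 0 -> s f = - f -> exists m, vord q f = m * 2 + 1.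
Proof.
have [sC sK _ sv] := Hs; move=> f0 sf; have [[m vf]|//] := int_parity (vord q f).
have [t vt] := vord_normalized q.
have t0 : t != 0 by apply/eqP => t0; move: vt; rewrite t0 vord0.
pose u := t * s t; have u0 : u != 0 by rewrite mulf_neq0 ?fmorph_eq0.
have vu : vord q u = 2 by rewrite vordM ?fmorph_eq0 // (sv _ _ Hq) vt.
have su : s u = u by rewrite rmorphM sK mulrC.
pose g := f * u ^ (- m).
have g0 : g != 0 by rewrite mulf_neq0 ?expfz_neq0.
have vg : vord q g = 0 by rewrite vordM ?expfz_neq0 // vordXz // vu vf; lia.
have sg : s g = - g by rewrite rmorphM fmorphXz su sf mulNr.
have [|c gc] := @residue _ _ q g; first by right; rewrite vg.
have /(has_value_auto sC (sv _ _ Hq)) := gc; rewrite sg => sgc.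
have c0 : c = 0.
  apply/eqP; have /eqP := has_value_inj sgc (has_valueN gc).
  by rewrite -subr_eq0 opprK -mulr2n -mulr_natr mulf_eq0 (negPf two_neq0) orbF.
by move: gc; rewrite c0 => /has_value0/(vord_geE g0); rewrite vg.
Qed.

Lemma even_order f : f != 0 -> s f = f -> exists m, vord q f = m * 2.
Proof.
have [_ _ [y y0 sy] _] := Hs; move=> f0 sf; have [//|[m vf]] := int_parity (vord q f).
have [n vy] := odd_order y0 sy.
have yf0 : y / f != 0 by rewrite mulf_neq0 ?invr_eq0.
have [|l] := odd_order yf0; first by rewrite rmorphM fmorphV sy sf mulNr.
rewrite vord_div // vy vf; lia.
Qed.

End Parity.

(** Translation by [delta] is the product of the reflections [P |-> s - P] and
    [P |-> (s + delta) - P]. *)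
Lemma translation_ex (P0 : cpoint X) (delta : Pic X) : in_Pic_deg 0 delta ->
  exists t : {rmorphism X -> X}, (forall c, t (C c) = C c) /\
    forall P f, vord P (t f) = vord (translate P delta) f.
Proof.
move=> d0; have [s1 [s1C _ _ s1v]] := reflection_ex P0 P0.
have [s2 [s2C _ _ s2v]] := reflection_ex P0 (translate P0 delta).
pose t : {rmorphism X -> X} := s1 \o s2.
exists t; split=> [c|P f]; first by rewrite /= s2C s1C.
have [P1 HP1] := conj_pt_ex genusX P0 P0 P.
rewrite /= (s1v _ _ HP1); apply: s2v.
rewrite /conj_pt !divclD !(translateE genusX) //.
by rewrite addrA [RHS]addrA -!divclD [<< P1 >> + _]addrC HP1.
Qed.

End Reflections.

(** * Functions invariant under a translation of order 2 *)

Section InvariantFunctions.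
Variables (k : closedFieldType) (X : curve k).
Hypothesis genusX : has_genus X 1.
Variables (beta : Pic X) (t : {rmorphism X -> X}).
Hypothesis beta2 : beta *+ 2 = 0.
Hypothesis beta_neq0 : beta <> 0.
Hypothesis tC : forall c, t (const X c) = const X c.
Hypothesis tv : forall P f, vord P (t f) = vord (translate P beta) f.
Implicit Types (P Q R : cpoint X) (f g h x y : X) (D E : {freeg (cpoint X) / int}).
Local Notation C := (const X).

Let transE P : divcl << translate P beta >> = divcl << P >> + beta.
Proof. by apply: translateE => //; apply: two_torsion_deg0 beta2. Qed.

Lemma translate2K P : translate (translate P beta) beta = P.
Proof. by apply: (pt_inj genusX); rewrite !transE -addrA -mulr2n beta2 addr0. Qed.

Lemma translate_neq P : translate P beta <> P.
Proof.
move=> /(congr1 (fun Q => divcl << Q >>)); rewrite transE => /eqP.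
by rewrite -subr_eq0 addrAC subrr add0r => /eqP.
Qed.

Lemma translation_invol (P0 : cpoint X) f : t (t f) = f.
Proof.
apply: (eq_from_values genusX P0) => P c.
by move=> /(has_value_auto tC (tv _)) /(has_value_auto tC (tv _)); rewrite translate2K.
Qed.

Hypothesis two_neq0 : 2%:R != 0 :> k.

Lemma deg_ge_of_coeff E : (forall P, 0 <= coeff P E) -> 0 <= deg E.
Proof.
move=> H; apply: (Lspace_deg_ge0 genusX _ (oner_neq0 X)) => P.
by right; rewrite vord1 oppr_le0.
Qed.

(** An invariant function with at most three poles has them at some
    [b], [b + beta], so that its fibres are the pairs [q], [q + beta]. Then
    [2 q] has the same class for all [q], and a reflection would fix every point. *)
Lemma invariant_const (P0 : cpoint X) E f : t f = f -> (forall P, 0 <= coeff P E) -> deg E <= 3 ->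
  Lspace E f -> exists c, f = C c.
Proof.
move=> tf E0 E3 Hf; apply: contrapT => nc.
have {}nc z : f != C z by apply/eqP => fz; apply: nc; exists z.
have [b [f0 vb]] := nonconst_pole genusX P0 nc.
have [b' b'E] : exists b', translate b beta = b' by exists (translate b beta).
have b'K : translate b' beta = b by rewrite -b'E translate2K.
have vt P : vord (translate P beta) f = vord P f by rewrite -tv tf.
have HE P : - coeff P E <= vord P f by apply: vord_geE (Hf P).
have bb' : (b == b') = false.
  by apply/eqP => E1; apply: (@translate_neq b); rewrite b'E -E1.
have four c : (forall P, (b == P)%:Z + (b' == P)%:Z + (c == P)%:Z +
    (translate c beta == P)%:Z <= coeff P E) -> False.
  move=> H; have : 0 <= deg (E - << b >> - << b' >> - << c >> - << translate c beta >>).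
    by apply: deg_ge_of_coeff => P; rewrite !coeffB1; have := H P; lia.
  by rewrite !degB1; lia.
have HD : Lspace (<< b >> + << b' >>) f.
  move=> c; right; rewrite coeffD !coeff_pt leNgt; apply/negP => vc.
  have vb' : vord b' f = vord b f by rewrite -b'E vt.
  have vc' := vt c.
  have two : vord b f < -1 -> False.
    move=> vb2; apply: (four b) => P; have := E0 P; have := HE P; rewrite b'E.
    case: (b =P P) => [<-|_]; first by rewrite eq_sym bb'; lia.
    by case: (b' =P P) => [<-|_]; lia.
  have [cb|/eqP cb] := eqVneq c b.
    by apply: two; move: vc; rewrite cb eqxx eq_sym bb'; lia.
  have [cb'|/eqP cb'] := eqVneq c b'.
    by apply: two; move: vc; rewrite cb' eqxx bb' vb'; lia.
  have tr_inj P Q : translate P beta = Q -> P = translate Q beta.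
    by move=> <-; rewrite translate2K.
  have c'b : translate c beta <> b by move=> /tr_inj; rewrite b'E.
  have c'b' : translate c beta <> b' by move=> /tr_inj; rewrite b'K.
  have c'c := @translate_neq c; move/eqP: bb' => bb'.
  have {}vc : vord c f < 0.
    by move: vc; rewrite (introF eqP (nesym cb)) (introF eqP (nesym cb')).
  apply: (four c) => P; have := E0 P; have := HE P.
  case: (b =P P) => [<-|_].
    by rewrite (introF eqP (nesym bb')) (introF eqP cb) (introF eqP c'b); lia.
  case: (b' =P P) => [<-|_].
    by rewrite (introF eqP cb') (introF eqP c'b'); lia.
  case: (c =P P) => [<-|_]; first by rewrite (introF eqP c'c); lia.
  by case: (translate c beta =P P) => [<-|_]; lia.
have dD : deg (<< b >> + << b' >> : {freeg (cpoint X) / int}) = 2 by rewrite degD !deg_pt.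
have fib q : conj_pt b b' q (translate q beta).
  rewrite /conj_pt; set q' := translate q beta.
  have [qb|/eqP bq] := eqVneq q b; first by rewrite /q' qb b'E.
  have [qb'|/eqP b'q] := eqVneq q b'.
    by rewrite /q' qb' b'K addrC.
  have bq' : b <> q' by move=> E1; apply: b'q; rewrite -b'E E1 translate2K.
  have b'q' : b' <> q' by move=> E1; apply: bq; rewrite -b'K E1 translate2K.
  have qq' : q <> q' by move/esym/translate_neq.
  have [|c fc] := @residue _ _ q f.
    have := HD q; rewrite coeffD !coeff_pt.
    by move/nesym/eqP/negPf: bq => ->; move/nesym/eqP/negPf: b'q => ->.
  have fc0 : f - C c != 0 by rewrite subr_eq0.
  have fcq : 1 <= vord q (f - C c) by apply: vord_geE.
  have fcq' : 1 <= vord q' (f - C c).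
    by rewrite -tv rmorphB tC tf.
  have Hc : Lspace (<< b >> + << b' >>) (f - C c).
    apply: LspaceD => // P; apply: vord_geN; apply: vord_geW (vord_geC P c).
    by rewrite oppr_le0 coeffD !coeff_pt; lia.
  have H1 : Lspace (<< b >> + << b' >> - << q >>) (f - C c).
    apply: Lspace_sub => //; rewrite coeffD !coeff_pt.
    by move/nesym/eqP/negPf: bq => ->; move/nesym/eqP/negPf: b'q => ->; lia.
  have H2 : Lspace (<< b >> + << b' >> - << q >> - << q' >>) (f - C c).
    apply: Lspace_sub => //; rewrite coeffB1 coeffD !coeff_pt.
    by move/eqP/negPf: bq' => ->; move/eqP/negPf: b'q' => ->; move/eqP/negPf: qq' => ->; lia.
  apply/divclP; exists (f - C c) => // P.
  rewrite (Lspace_deg0 genusX H2 fc0); last by rewrite !degB1 dD.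
  by rewrite !coeffB1 coeffB !coeffD !coeff_pt; lia.
have double q : conj_pt b b q q.
  have := fib q; rewrite /conj_pt !divclD -b'E !transE !addrA => /eqP.
  by rewrite (inj_eq (addIr beta)) => /eqP.
have [s [sC _ [y y0 sy] sv]] := reflection_ex genusX two_neq0 b b.
case: (opp_neq two_neq0 y0); rewrite -sy.
apply: (eq_from_values genusX b) => P c.
by move/(has_value_auto sC (sv _ _ (double P))).
Qed.

End InvariantFunctions.

(** * The quotient by a translation of order 2 *)

Section Quotient.
Variables (k : closedFieldType) (X Y : curve k) (phi : cmorphism X Y).
Hypothesis genusX : has_genus X 1.
Variables (beta : Pic X) (t : {rmorphism X -> X}).
Hypothesis beta2 : beta *+ 2 = 0.
Hypothesis beta_neq0 : beta <> 0.
Hypothesis phiP : quotient_by phi beta.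
Hypothesis tC : forall c, t (const X c) = const X c.
Hypothesis tv : forall P f, vord P (t f) = vord (translate P beta) f.
Variable P0 : cpoint X.
Implicit Types (P R S : cpoint X) (Q : cpoint Y) (f : X) (g : Y).
Implicit Types (D E : {freeg (cpoint X) / int}).

Let tK := translation_invol genusX beta2 tC tv P0.
Let trans_neq := translate_neq genusX beta2 beta_neq0.

Lemma invariant_pullback f : (exists g, f = pullback phi g) <-> t f = f.
Proof.
have [_ _ H] := phiP; split=> [/H Hf|tf].
  by apply/esym/(eq_from_values genusX P0) => P c /Hf /(has_value_auto tC (tv P)).
by apply/H => P c; rewrite -{1}tf; apply: has_value_auto.
Qed.

Lemma fiber_translate P : phi (translate P beta) = phi P.
Proof. by have [_ H _] := phiP; apply/esym/H; right. Qed.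

(** The divisor is [P + S - R - R'], where [R'] is the point of class
    [P + S - R]; all but finitely many [R] and [S] keep [R], [S] and [R'] away
    from [P] and [P + beta]. *)
Lemma separating_function P : exists f, [/\ f != 0, vord P f = 1 &
  vord (translate P beta) f = 0].
Proof.
set P' := translate P beta.
have [R] := points_infinite genusX P0 [:: P; P'].
move=> /notin_cons[RP /notin_cons[RP' _]].
have [S] := points_infinite genusX P0 [:: P; P'; R; translate R beta].
move=> /notin_cons[SP /notin_cons[SP' /notin_cons[SR /notin_cons[SR' _]]]].
have [|R' HR'] := @deg1_pt _ _ genusX (<< P >> + << S >> - << R >>).
  by rewrite degB1 degD !deg_pt.
have transE T : divcl << translate T beta >> = divcl << T >> + beta.
  by apply: translateE => //; apply: two_torsion_deg0 beta2.
have R'P : R' <> P.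
  move=> E; apply: SR; apply: (pt_inj genusX); move: HR'.
  by rewrite E divclB divclD -addrA -[LHS]addr0 => /addrI/esym/eqP; rewrite subr_eq0 => /eqP.
have R'P' : R' <> P'.
  move=> E; apply: SR'; apply: (pt_inj genusX); move: HR'.
  rewrite E divclB divclD !transE -addrA => /addrI bE.
  by rewrite bE [RHS]addrC subrK.
have /divclP[f f0 Hf] : divcl (<< P >> + << S >> - << R >>) = divcl << R' >> by rewrite HR'.
exists f; split=> //; rewrite -Hf !coeffB1 coeffD !coeff_pt.
  rewrite eqxx (introF eqP SP) (introF eqP RP) (introF eqP R'P); lia.
rewrite (introF eqP (nesym (trans_neq (P := P)))) (introF eqP SP').
by rewrite (introF eqP RP') (introF eqP R'P'); lia.
Qed.

Lemma norm_invariant f : t (f * t f) = f * t f.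
Proof. by rewrite rmorphM tK mulrC. Qed.

(** The norm of a separating function at [P] is invariant and has order 1 at [P]. *)
Lemma quotient_unramified P g : vord P (pullback phi g) = vord (phi P) g.
Proof.
have [e e0 He] := mor_vord phi P; rewrite He.
have [f [f0 vf vf']] := separating_function P.
have /invariant_pullback[h Hh] := norm_invariant f.
have : vord P (f * t f) = 1 by rewrite vordM ?fmorph_eq0 // tv vf vf'.
rewrite Hh He => eh; have e1 : e = 1%N.
  by have /eqP := congr1 absz eh; rewrite abszM muln_eq1 => /andP[/eqP].
by rewrite e1 mul1r.
Qed.

Lemma pushB D E : push phi (D - E) = push phi D - push phi E.
Proof. exact: lift_is_additive. Qed.

Lemma push0 : push phi 0 = 0.
Proof. by have := pushB 0 0; rewrite !subrr. Qed.

Lemma pushD D E : push phi (D + E) = push phi D + push phi E.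
Proof.
have -> : D + E = D - (0 - E) by rewrite sub0r opprK.
by rewrite !pushB push0 sub0r opprK.
Qed.

Lemma push_pt P : push phi << P >> = << phi P >>.
Proof. by rewrite /push liftU scale1r. Qed.

Lemma coeff_push P D :
  coeff (phi P) (push phi D) = coeff P D + coeff (translate P beta) D.
Proof.
have fibE R : (phi R == phi P)%:Z = (R == P)%:Z + (R == translate P beta)%:Z.
  have [_ H _] := phiP; case: (R =P P) => [->|RP].
    by rewrite eqxx (introF eqP (nesym (trans_neq (P := P)))).
  case: (R =P translate P beta) => [->|RP']; first by rewrite fiber_translate eqxx.
  by have nRP : phi R <> phi P; [move=> /esym/H[] | rewrite (introF eqP nRP)].
elim/freeg_ind_dom0: D => [|n R D _ _ IH].
  by rewrite push0 !coeff_0.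
have -> : push phi (<< n *g R >> + D) = n *: << phi R >> + push phi D.
  by rewrite pushD {1}/push liftU.
rewrite !coeffD coeffZ coeff_pt IH fibE !coeffU.
by case: (R == P); case: (R == translate P beta); lia.
Qed.

Lemma phi_surj Q : exists P, phi P = Q.
Proof. by have [H _ _] := phiP. Qed.

(** The function is the one whose pull-back is the norm [f t(f)]. *)
Lemma push_principal D f : f != 0 -> (forall P, coeff P D = vord P f) ->
  exists2 g, g != 0 & forall Q, coeff Q (push phi D) = vord Q g.
Proof.
move=> f0 Hf; have /invariant_pullback[g Hg] := norm_invariant f.
have tf0 : t f != 0 by rewrite fmorph_eq0.
exists g.
  by apply: contraNneq (mulf_neq0 f0 tf0) => g0; rewrite Hg g0 rmorph0.
move=> Q; have [P <-] := phi_surj Q; rewrite coeff_push !Hf -quotient_unramified -Hg.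
by rewrite vordM ?fmorph_eq0 // tv.
Qed.

Lemma Pic_push_translate P (delta : Pic X) : in_Pic_deg 0 delta ->
  divcl << phi (translate P delta) >> = divcl << phi P >> + Pic_push phi delta.
Proof.
move=> d0; set D : {freeg (cpoint X) / int} := repr (delta : Quotient.quot (@principal k X)).
have DE : divcl D = delta by apply: reprK.
have /divclP[f f0 Hf] : divcl (<< translate P delta >> - << P >>) = divcl D.
  by rewrite divclB (translateE genusX) // addrAC subrr add0r DE.
apply/eqP; rewrite addrC -subr_eq /Pic_push -/D -divclB; apply/eqP/divclP.
have [g g0 Hg] := push_principal f0 Hf; exists g => // Q.
by rewrite -Hg !pushB !push_pt.
Qed.

Hypothesis two_neq0 : 2%:R != 0 :> k.

(** A function with divisor [Q - Q'] pulls back to an invariant function with two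
    poles, which is constant; thus the quotient curve is not rational. *)
Lemma quotient_pt_inj Q Q' : divcl << Q >> = divcl << Q' >> -> Q = Q'.
Proof.
move=> /divclP[g g0 Hg]; have [b bQ'] := phi_surj Q'; have [a aQ] := phi_surj Q.
pose f := pullback phi g.
have vf P : vord P f = (Q == phi P)%:Z - (Q' == phi P)%:Z.
  by rewrite quotient_unramified -Hg coeffB !coeff_pt.
have tf : t f = f by apply/invariant_pullback; exists g.
have [||| c fc] := @invariant_const _ _ genusX beta t beta2 beta_neq0 tC tv two_neq0 P0
    (<< b >> + << translate b beta >>) f tf.
- by move=> P; rewrite coeffD !coeff_pt; lia.
- by rewrite degD !deg_pt.
- move=> P; right; rewrite vf coeffD !coeff_pt -bQ'.
  have [_ H _] := phiP; case: (phi b =P phi P) => [/H[->|E]|_].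
  + by rewrite eqxx; case: eqP; case: eqP => //=; lia.
  + by rewrite -E eqxx; case: eqP; case: eqP => //=; lia.
  + by case: eqP; do !case: eqP => //=; lia.
have := vf a; rewrite fc vord_const aQ eqxx => /esym/eqP.
by rewrite subr_eq0 -aQ; case: (Q' =P phi a).
Qed.

Lemma translate_quotient P (delta : Pic X) : in_Pic_deg 0 delta ->
  translate (phi P) (Pic_push phi delta) = phi (translate P delta).
Proof.
move=> d0; rewrite {1}/translate; case: xgetP => [Q _ /= HQ|/(_ (phi (translate P delta)))].
  by apply: quotient_pt_inj; rewrite HQ Pic_push_translate.
by case; apply: Pic_push_translate.
Qed.

End Quotient.

(** * Maps to the plane *)

Section Triples.
Variable R : comNzRingType.
Implicit Types u v w : 'rV[R]_3.

Definition i0 : 'I_3 := @Ordinal 3 0 isT.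
Definition i1 : 'I_3 := @Ordinal 3 1 isT.
Definition i2 : 'I_3 := @Ordinal 3 2 isT.

Lemma sum3 (V : nmodType) (F : 'I_3 -> V) : \sum_(j < 3) F j = F i0 + F i1 + F i2.
Proof.
rewrite !big_ord_recl big_ord0 addr0 addrA.
by congr (F _ + F _ + F _); apply: val_inj.
Qed.

Lemma ord3P (P : 'I_3 -> Prop) : P i0 -> P i1 -> P i2 -> forall j, P j.
Proof.
move=> P0 P1 P2 [[|[|[|//]]] lt].
- by rewrite (_ : Ordinal lt = i0) //; apply: val_inj.
- by rewrite (_ : Ordinal lt = i1) //; apply: val_inj.
- by rewrite (_ : Ordinal lt = i2) //; apply: val_inj.
Qed.

Definition cross u v : 'rV[R]_3 := \row_j
  (if j == i0 then u 0 i1 * v 0 i2 - u 0 i2 * v 0 i1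
   else if j == i1 then u 0 i2 * v 0 i0 - u 0 i0 * v 0 i2
   else u 0 i0 * v 0 i1 - u 0 i1 * v 0 i0).

Lemma cross0E u v : cross u v 0 i0 = u 0 i1 * v 0 i2 - u 0 i2 * v 0 i1.
Proof. by rewrite mxE. Qed.
Lemma cross1E u v : cross u v 0 i1 = u 0 i2 * v 0 i0 - u 0 i0 * v 0 i2.
Proof. by rewrite mxE. Qed.
Lemma cross2E u v : cross u v 0 i2 = u 0 i0 * v 0 i1 - u 0 i1 * v 0 i0.
Proof. by rewrite mxE. Qed.
Definition crossE := (cross0E, cross1E, cross2E).

Lemma cross_eq0_sym u v : cross u v = 0 -> forall i j, u 0 i * v 0 j = u 0 j * v 0 i.
Proof.
move=> /rowP uv; have := uv i0; have := uv i1; have := uv i2.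
rewrite !crossE !mxE => /eqP + /eqP + /eqP; rewrite !subr_eq0 => /eqP e2 /eqP e1 /eqP e0.
by do 2!apply: ord3P.
Qed.

End Triples.

Section ProjectiveLine.
Variable k : fieldType.
Implicit Types u v w : 'rV[k]_3.

Lemma row3_neq0 (u : 'rV[k]_3) : u != 0 -> exists j, u 0 j != 0.
Proof. by case/rV0Pn => j; exists j. Qed.

Lemma cross_eq0 u v : u != 0 -> cross u v = 0 -> exists c, v = c *: u.
Proof.
move=> /row3_neq0[j uj] /cross_eq0_sym uv; exists (v 0 j / u 0 j).
apply/rowP => i; rewrite mxE; apply: (mulfI uj).
by rewrite uv; field.
Qed.

(** The identity [(u x v) x w = (w . u) v - (w . v) u] makes [w] parallel to [u x v]. *)
Lemma orthogonal_cross u v w : cross u v != 0 -> w != 0 ->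
  \sum_(j < 3) w 0 j * u 0 j = 0 -> \sum_(j < 3) w 0 j * v 0 j = 0 ->
  exists2 c, c != 0 & w = c *: cross u v.
Proof.
move=> uv0 w0; rewrite !sum3 => wu wv.
have [|c wE] := @cross_eq0 (cross u v) w uv0.
  apply/rowP.
  have wu0 a b : a * (w 0 i0 * u 0 i0 + w 0 i1 * u 0 i1 + w 0 i2 * u 0 i2) -
      b * (w 0 i0 * v 0 i0 + w 0 i1 * v 0 i1 + w 0 i2 * v 0 i2) = 0.
    by rewrite wu wv !mulr0 subr0.
  apply: ord3P; rewrite !crossE !mxE.
  - by rewrite -[RHS](wu0 (v 0 i0) (u 0 i0)); ring.
  - by rewrite -[RHS](wu0 (v 0 i1) (u 0 i1)); ring.
  - by rewrite -[RHS](wu0 (v 0 i2) (u 0 i2)); ring.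
by exists c => //; apply: contraNneq w0 => c0; rewrite wE c0 scale0r.
Qed.

Lemma vline_scale (c : k) u : c != 0 -> (<[c *: u]> = <[u]>)%VS.
Proof.
move=> c0; apply/eqP; rewrite eqEsubv; apply/andP; split.
  by rewrite -memvE rpredZ // memv_line.
by rewrite -memvE -[X in X \in _](scalerK c0) rpredZ // memv_line.
Qed.

Lemma P2_vline (x : P2 k) : exists2 u, u != 0 & val x = <[u]>%VS.
Proof.
have /eqP d1 := valP x; have u0 : vpick (val x) != 0.
  by rewrite vpick0 -dimv_eq0 d1.
exists (vpick (val x)) => //; apply/esym/eqP.
by rewrite eqEdim -memvE memv_pick dim_vline u0 d1.
Qed.

Lemma vline_P2 u : u != 0 -> exists x : P2 k, val x = <[u]>%VS.
Proof.
move=> u0; have d : \dim <[u]>%VS == 1%N by rewrite dim_vline u0.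
by exists (exist (fun V : {vspace 'rV[k]_3} => \dim V == 1%N) _ d).
Qed.

End ProjectiveLine.

Section PlaneMaps.
Variables (k : closedFieldType) (X : curve k).
Implicit Types (P Q : cpoint X) (f g h : X) (D E : {freeg (cpoint X) / int}).
Local Notation C := (const X).

Lemma has_value_lincomb (e : 'rV[X]_3) P h (u a : 'rV[k]_3) :
  (forall j, has_value P (h * e 0 j) (u 0 j)) ->
  has_value P (h * lincomb a e) (\sum_(j < 3) a 0 j * u 0 j).
Proof.
move=> H; have -> : h * lincomb a e = \sum_j C (a 0 j) * (h * e 0 j).
  by rewrite mulr_sumr; apply: eq_bigr => j _; rewrite mulrCA.
by apply: has_value_sum => j; apply: has_valueM => //; apply: has_valueC.
Qed.

Lemma has_value_cross (e e' : 'rV[X]_3) P h h' (u u' : 'rV[k]_3) :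
  (forall j, has_value P (h * e 0 j) (u 0 j)) ->
  (forall j, has_value P (h' * e' 0 j) (u' 0 j)) ->
  forall j, has_value P ((h * h') * cross e e' 0 j) (cross u u' 0 j).
Proof.
move=> He He'.
have H a b c d : has_value P (h * h' * (e 0 a * e' 0 b - e 0 c * e' 0 d))
    (u 0 a * u' 0 b - u 0 c * u' 0 d).
  have -> : h * h' * (e 0 a * e' 0 b - e 0 c * e' 0 d) =
    (h * e 0 a) * (h' * e' 0 b) - (h * e 0 c) * (h' * e' 0 d) by ring.
  by apply: has_valueB; apply: has_valueM.
by apply: ord3P; rewrite !crossE; apply: H.
Qed.

Lemma local_coords_vord (e : 'rV[X]_3) P h u : local_coords e P h u ->
  [/\ h != 0, exists2 j, e 0 j != 0 & vord P h = - vord P (e 0 j) &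
      forall j, vord_ge P (- vord P h) (e 0 j)].
Proof.
move=> [/row3_neq0[j uj] H]; have [he0 vhe] := has_value_unit (H j) uj.
have [h0 e0] : h != 0 /\ e 0 j != 0.
  by move: he0; rewrite mulf_eq0 negb_or => /andP[].
split=> //.
  by exists j => //; move: vhe; rewrite vordM //; lia.
move=> i; have [->|ei] := eqVneq (e 0 i) 0; first by left.
right; have := vord_geE (mulf_neq0 h0 ei) (has_value_ge0 (H i)).
by rewrite vordM //; lia.
Qed.

Lemma given_by_scale (e : 'rV[X]_3) (i : cpoint X -> P2 k) h :
  h != 0 -> given_by e i -> given_by (h *: e) i.
Proof.
move=> h0 H P; have [g [u [[u0 Hu] iP]]] := H P.
exists (g / h), u; split=> //; split=> // j; rewrite mxE.
by have -> : g / h * (h * e 0 j) = g * e 0 j by field.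
Qed.

Lemma local_coords_scale (e : 'rV[X]_3) P h g u : g != 0 ->
  local_coords (g *: e) P h u <-> local_coords e P (h * g) u.
Proof.
by move=> g0; split=> -[u0 H]; split=> // j; have := H j; rewrite mxE mulrA.
Qed.

Lemma basis_scale D E n (e : 'rV[X]_n) h : h != 0 ->
  (forall P, coeff P (D - E) = vord P h) -> is_basis_L D e -> is_basis_L E (h *: e).
Proof.
move=> h0 Hh [He gen]; have vh P : vord P h = coeff P D - coeff P E.
  by rewrite -Hh coeffB.
split=> [j P|g Hg].
  rewrite mxE; have -> : - coeff P E = vord P h + - coeff P D by rewrite vh; lia.
  by apply: vord_geM; [apply: vord_geI|apply: He].
have [P|c [gc uc]] := gen (h^-1 * g).
  have -> : - coeff P D = vord P h^-1 + - coeff P E by rewrite vordV // vh; lia.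
  by apply: vord_geM; [apply: vord_geI|apply: Hg].
exists c; split=> [|d gd]; first by rewrite lincomb_scale -gc mulrA divff // mul1r.
by apply: uc; rewrite gd lincomb_scale mulrA mulVf // mul1r.
Qed.

Hypothesis genusX : has_genus X 1.
Variable P0 : cpoint X.

(** As the system has no base point, clearing denominators at [P] means
    multiplying by a function of order exactly [coeff P D]. *)
Lemma coords_vord D (e : 'rV[X]_3) P h u : is_basis_L D e -> 1 < deg D ->
  local_coords e P h u -> vord P h = coeff P D.
Proof.
move=> be D1 /local_coords_vord[h0 [j ej vh] ge].
have [j' vj'] := basis_no_basepoint genusX P0 P be D1.
have := vord_geE ej (be.1 j P).
have := vord_geE (lfree_neq0 (basis_lfree be) j') (ge j').
by rewrite vj' vh; lia.
Qed.

(** Two triples defining the same map are proportional as functions, since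
    their minors vanish at almost all points. *)
Lemma given_by_proportional (e g : 'rV[X]_3) (i : cpoint X -> P2 k) :
  given_by e i -> given_by g i -> exists2 h, h != 0 & g = h *: e.
Proof.
move=> He Hg.
have /choice[s Hs] (j : 'I_3) : finite_poles (e 0 j) by apply: all_finite_poles.
have /choice[r Hr] (j : 'I_3) : finite_poles (g 0 j) by apply: all_finite_poles.
pose S := flatten [seq s j ++ r j | j <- enum 'I_3].
have inS P j : P \notin S -> P \notin s j /\ P \notin r j.
  move=> PS; apply/andP; rewrite -negb_or -mem_cat; apply: contra PS => PS.
  by apply/flattenP; exists (s j ++ r j) => //; apply: map_f; rewrite mem_enum.
have e0 : e != 0.
  have [h [u [/local_coords_vord[_ [j ej _] _] _]]] := He P0.
  by apply: contraNneq ej => ->; rewrite mxE.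
have minor a b : e 0 a * g 0 b = e 0 b * g 0 a.
  apply/eqP; rewrite -subr_eq0; apply/eqP/(almost_all_zero genusX P0 (s := S)) => P PS.
  have [h [u [Hu iP]]] := He P; have [h' [u' [Hu' iP']]] := Hg P.
  have [h0 [j ej vh] _] := local_coords_vord Hu.
  have [h'0 [j' gj vh'] _] := local_coords_vord Hu'.
  have [c uc] : exists c, u' = c *: u.
    by apply/vlineP; rewrite -iP iP' memv_line.
  have hh0 : h * h' != 0 by rewrite mulf_neq0.
  set z := _ - _; have : has_value P (h * h' * z) 0.
    have -> : h * h' * z = (h * e 0 a) * (h' * g 0 b) - (h * e 0 b) * (h' * g 0 a).
      by rewrite /z; ring.
    have -> : 0 = u 0 a * u' 0 b - u 0 b * u' 0 a :> k by rewrite uc !mxE; ring.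
    by apply: has_valueB; apply: has_valueM; [apply: Hu.2|apply: Hu'.2|apply: Hu.2|apply: Hu'.2].
  move/has_value0; have [-> _|z0 /(vord_geE (mulf_neq0 hh0 z0))] := eqVneq z 0; first by left.
  rewrite !vordM // vh vh' => vz; right.
  have := vord_geE ej (Hs j P (inS P j PS).1).
  by have := vord_geE gj (Hr j' P (inS P j' PS).2); lia.
have [j ej] := row3_neq0 e0; exists (g 0 j / e 0 j); last first.
  by apply/rowP => a; rewrite mxE; apply: (mulfI ej); rewrite minor; field.
rewrite mulf_neq0 ?invr_eq0 //; apply/eqP => gj.
have [h [u [/local_coords_vord[_ [a ga _] _] _]]] := Hg P0.
case/eqP: ga; apply: (mulfI ej); by rewrite minor gj !mulr0.
Qed.

Variables (D : {freeg (cpoint X) / int}) (e : 'rV[X]_3) (i : cpoint X -> P2 k).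
Hypothesis be : is_basis_L D e.
Hypothesis D3 : deg D = 3.
Hypothesis ei : given_by e i.

(** A line meeting the curve with multiplicity 3 at [p] cuts out the divisor
    [3 p], because the system has no base point. *)
Lemma flex_class p : is_flex i p -> divcl D = divcl (<< p >> *+ 3).
Proof.
move=> [g [gi _ [l [h [u [a [Hu la Hl]]]]]]].
have [c c0 gE] := given_by_proportional ei gi.
have a0 : a != 0.
  by have /eqP := valP l; rewrite la dim_vline; case: eqP.
pose f := lincomb a e; have f0 : f != 0 by apply: contraNneq a0 => /(basis_lfree be) ->.
have Hf : Lspace D f by apply/Lspace_lincomb/be.1.
move: Hu; rewrite gE => /(local_coords_scale _ _ _ _ c0) Hu.
have vhc : vord p (h * c) = coeff p D by apply: (coords_vord be) Hu; rewrite D3.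
have [hc0 _ _] := local_coords_vord Hu.
have vf : 3 - coeff p D <= vord p f.
  move: Hl; rewrite gE lincomb_scale mulrA -/f => /(vord_geE (mulf_neq0 hc0 f0)).
  by rewrite vordM // vhc; lia.
apply/divclP; exists f^-1; first by rewrite invr_eq0.
have H3 : Lspace (D - << p >> *+ 3) f.
  move=> P; right; rewrite coeffB coeffMn coeff_pt.
  case: (p =P P) => [<-|_]; first by move: vf; lia.
  by rewrite mul0rn subr0; apply: vord_geE (Hf P).
have d0 : deg (D - << p >> *+ 3) = 0 by rewrite degB degMn deg_pt D3.
by move=> P; rewrite vordV // (Lspace_deg0 genusX H3 f0 d0) opprK.
Qed.

(** Sections vanishing at [P] but not at [P'] separate the two points. *)
Lemma coords_separate P P' h u h' u' : P <> P' ->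
  local_coords e P h u -> local_coords e P' h' u' -> cross u u' != 0.
Proof.
move=> PP' Hu Hu'; apply/eqP => /(cross_eq0 Hu.1)[c uc].
have D1 : 1 < deg D by rewrite D3.
have DP1 : 1 < deg (D - << P >>) by rewrite degB1 D3.
have [f [f0 Hf vf]] := Lspace_strict genusX P0 P' DP1.
have vh := coords_vord be D1 Hu; have vh' := coords_vord be D1 Hu'.
have [h0 _ _] := local_coords_vord Hu; have [h'0 _ _] := local_coords_vord Hu'.
have [a [fa _]] := be.2 _ (Lspace_addpt Hf).
have v0 : \sum_(j < 3) a 0 j * u 0 j = 0.
  apply: has_value_inj (has_value_lincomb a Hu.2) _.
  apply/has_value0; rewrite -fa; right; rewrite vordM // vh.
  by have := vord_geE f0 (Hf P); rewrite coeffB1 eqxx; lia.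
have := has_value_lincomb a Hu'.2; rewrite -fa.
have -> : \sum_(j < 3) a 0 j * u' 0 j = 0.
  transitivity (c * \sum_(j < 3) a 0 j * u 0 j); last by rewrite v0 mulr0.
  by rewrite mulr_sumr; apply: eq_bigr => j _; rewrite uc mxE; ring.
move=> /has_value0 /(vord_geE (mulf_neq0 h'0 f0)); rewrite vordM // vh' vf coeffB1.
by rewrite (introF eqP PP'); lia.
Qed.

End PlaneMaps.

(** * Weierstrass coordinates at a flex *)

Section Weierstrass.
Variables (k : closedFieldType) (X : curve k).
Hypothesis genusX : has_genus X 1.
Variable p : cpoint X.
Implicit Types (P Q q : cpoint X) (f g h x y : X) (D E : {freeg (cpoint X) / int}).
Local Notation C := (const X).

Lemma coeff_mult_pt n P : coeff P (<< p >> *+ n) = (if p == P then n%:Z else 0) :> int.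
Proof. by rewrite coeffMn coeff_pt; case: eqP => _; rewrite ?mul0rn // -[RHS]natz. Qed.

Lemma mult_ptS n : << p >> *+ n.+1 - << p >> = << p >> *+ n :> {freeg (cpoint X) / int}.
Proof. by rewrite mulrSr addrK. Qed.

Lemma Lspace_reduce D P f y : Lspace D f -> Lspace D y -> y != 0 ->
  vord P y = - coeff P D -> exists c, Lspace (D - << P >>) (f - C c * y).
Proof.
move=> Hf Hy y0 vy; have [|c Hc] := @residue _ _ P (f / y).
  by rewrite -(subrr (coeff P D)) addrC; apply: vord_geM => //; right; rewrite vordV // vy opprK.
exists c => Q; rewrite coeffB1; case: (P =P Q) => [<-|_].
  have -> : f - C c * y = (f / y - C c) * y by field.
  have -> : - (coeff P D - true%:Z) = 1 + vord P y by rewrite vy /=; lia.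
  by apply: vord_geM => //; apply: vord_geI.
by rewrite subr0; apply: vord_geB; [apply: Hf | apply/vord_geZ/Hy].
Qed.

Section Coordinates.
Variables x y : X.
Hypothesis Hx : Lspace (<< p >> *+ 2) x.
Hypothesis vx : vord p x = -2.
Hypothesis Hy : Lspace (<< p >> *+ 3) y.
Hypothesis vy : vord p y = -3.

Let x0 : x != 0. Proof. by apply/eqP => x0; move: vx; rewrite x0 vord0. Qed.
Let y0 : y != 0. Proof. by apply/eqP => y0; move: vy; rewrite y0 vord0. Qed.

Lemma coords3 f : Lspace (<< p >> *+ 3) f ->
  exists a b c, f = C a + C b * x + C c * y.
Proof.
move=> Hf; have [|c] := Lspace_reduce Hf Hy y0 (P := p).
  by rewrite vy coeff_mult_pt eqxx.
rewrite mult_ptS => Hf2.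
have [|b] := Lspace_reduce Hf2 Hx x0 (P := p).
  by rewrite vx coeff_mult_pt eqxx.
rewrite mult_ptS mulr1n => /(Lspace1_const genusX)[a fE].
by exists a, b, c; rewrite -fE; ring.
Qed.

Lemma coords3_free a b c : C a + C b * x + C c * y = 0 -> [/\ a = 0, b = 0 & c = 0].
Proof.
move=> E; have c0 : c = 0.
  apply/eqP/negPn/negP => c0.
  have [||/eqP[]] := @vord_addl _ _ p (C c * y) (C a + C b * x).
  - by rewrite mulf_neq0 ?const_neq0.
  - rewrite vordZ // vy; apply: vord_geD; first by right; rewrite vord_const.
    by apply: vord_geZ; right; rewrite vx.
  - by rewrite addrC E.
move: E; rewrite c0 rmorph0 mul0r addr0 => E.
have b0 : b = 0.
  apply/eqP/negPn/negP => b0.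
  have [||/eqP[]] := @vord_addl _ _ p (C b * x) (C a).
  - by rewrite mulf_neq0 ?const_neq0.
  - by rewrite vordZ // vx; right; rewrite vord_const.
  - by rewrite addrC E.
move: E; rewrite b0 rmorph0 mul0r addr0 => /eqP; rewrite fmorph_eq0 => /eqP a0.
by [].
Qed.

End Coordinates.

Hypothesis two_neq0 : 2%:R != 0 :> k.
Variable s : {rmorphism X -> X}.
Hypothesis Hs : reflection p p s.

Let conj_pp : conj_pt p p p p. Proof. by []. Qed.

Lemma Lspace_reflection n f : Lspace (<< p >> *+ n) f -> Lspace (<< p >> *+ n) (s f).
Proof.
have [_ _ _ sv] := Hs; move=> Hf P; have [P' HP] := conj_pt_ex genusX p p P.
apply/(vord_ge_auto (sv _ _ HP)); have := Hf P'.
by rewrite !coeff_mult_pt (conj_pt_eq genusX HP conj_pp).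
Qed.

(** The order at [p] of such a function would be odd and at least [- 2], leaving
    at most a simple pole, so the function would be an odd constant. *)
Lemma odd_section0 f : Lspace (<< p >> *+ 2) f -> s f = - f -> f = 0.
Proof.
have [sC _ _ _] := Hs; move=> Hf sf; apply/eqP/negPn/negP => f0.
have [m vf] := odd_order two_neq0 Hs conj_pp f0 sf.
have : Lspace (<< p >> *+ 2 - << p >>) f.
  apply: Lspace_sub => //; rewrite coeff_mult_pt eqxx vf.
  by have := vord_geE f0 (Hf p); rewrite coeff_mult_pt eqxx vf; lia.
rewrite mult_ptS mulr1n => /(Lspace1_const genusX)[c fc].
by case: (opp_neq two_neq0 f0); rewrite -sf fc sC.
Qed.

(** The coordinates of a Weierstrass equation centred at [p]: [x] is even and
    [y] odd for the reflection fixing [p]. *)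
Lemma weierstrass_coords : exists x y,
  [/\ Lspace (<< p >> *+ 2) x, vord p x = -2 & s x = x] /\
  [/\ Lspace (<< p >> *+ 3) y, vord p y = -3 & s y = - y].
Proof.
have [sC sK _ _] := Hs.
have dn n : deg (<< p >> *+ n : {freeg (cpoint X) / int}) = n%:Z.
  by rewrite degMn deg_pt -[RHS]natz.
have [|x [x0 Hx vx]] := Lspace_strict genusX p p (D := << p >> *+ 2); first by rewrite dn.
have [|z [z0 Hz vz]] := Lspace_strict genusX p p (D := << p >> *+ 3); first by rewrite dn.
have odd_part n f : Lspace (<< p >> *+ n) f ->
    Lspace (<< p >> *+ n) (f - s f) /\ s (f - s f) = - (f - s f).
  move=> Hf; split; first by apply: LspaceD => //; apply/LspaceN/Lspace_reflection.
  by rewrite rmorphB sK opprB.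
exists x, (z - s z); split.
  split=> //; first by rewrite vx coeff_mult_pt eqxx.
  have [/odd_section0 H /H /eqP] := odd_part _ _ Hx.
  by rewrite subr_eq0 => /eqP.
have [Hy sy] := odd_part _ _ Hz; split=> //.
have vz3 : vord p z = -3 by rewrite vz coeff_mult_pt eqxx.
have y0 : z - s z != 0.
  apply/negP => /eqP/eqP; rewrite subr_eq0 => /eqP/esym sz.
  by have [m] := even_order two_neq0 Hs conj_pp z0 sz; rewrite vz3; lia.
apply/eqP; rewrite eq_le; apply/andP; split; last first.
  by have := vord_geE y0 (Hy p); rewrite coeff_mult_pt eqxx.
rewrite leNgt; apply/negP => vy; case/eqP: (y0); apply: odd_section0 => //.
have -> : << p >> *+ 2 = << p >> *+ 3 - << p >> :> {freeg (cpoint X) / int}.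
  by rewrite mult_ptS.
by apply: Lspace_sub => //; rewrite coeff_mult_pt eqxx.
Qed.

Lemma odd_order_gt q n f : conj_pt p p q q -> s f = - f -> vord_ge q (n * 2) f ->
  vord_ge q (n * 2 + 1) f.
Proof.
move=> Hq sf; have [->|f0] := eqVneq f 0; first by left.
move=> /(vord_geE f0) vf; right; have [m vm] := odd_order two_neq0 Hs Hq f0 sf.
by move: vf; rewrite vm; lia.
Qed.

(** Some combination of two odd functions regular at a fixed point kills the
    linear term of their odd expansions, and so vanishes there to order 3. *)
Lemma odd_combination q f g : conj_pt p p q q -> s f = - f -> s g = - g ->
  vord_ge q 0 f -> vord_ge q 0 g ->
  exists b0 b1 : k, ((b0 != 0) || (b1 != 0)) /\ vord_ge q 3 (C b0 * f + C b1 * g).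
Proof.
have [sC _ _ _] := Hs; move=> Hq sf sg vf vg.
have vf1 := odd_order_gt (n := 0) Hq sf vf; have vg1 := odd_order_gt (n := 0) Hq sg vg.
have [f2|f2] := pselect (vord_ge q 2 f).
  exists 1, 0; rewrite oner_neq0 rmorph1 rmorph0 mul1r mul0r addr0; split=> //.
  exact: (odd_order_gt (n := 1)).
have f0 : f != 0 by apply/eqP => f0; apply: f2; left.
have vf' : vord q f = 1.
  have : ~ 2 <= vord q f by move=> H; apply: f2; right.
  by have := vord_geE f0 vf1; lia.
have [|c Hc] := @residue _ _ q (g / f).
  by rewrite -(subrr 1); apply: vord_geM => //; right; rewrite vordV // vf'.
exists (- c), 1; rewrite oner_neq0 orbT rmorph1 mul1r; split=> //.
have gE : C (- c) * f + g = (g / f - C c) * f by rewrite rmorphN; field.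
apply: (odd_order_gt (n := 1)) => //.
  by rewrite rmorphD rmorphM sC sf sg mulrN opprD.
by rewrite gE (_ : 1 * 2 = 1 + 1) //; apply: vord_geM => //; right; rewrite vf'.
Qed.

End Weierstrass.

(** * The map to the dual plane *)

Section DualMap.
Variables (k : closedFieldType) (X Y : curve k) (phi : cmorphism X Y).
Hypothesis genusX : has_genus X 1.
Variables (beta : Pic X) (t : {rmorphism X -> X}).
Hypothesis beta2 : beta *+ 2 = 0.
Hypothesis beta_neq0 : beta <> 0.
Hypothesis phiP : quotient_by phi beta.
Hypothesis tC : forall c, t (const X c) = const X c.
Hypothesis tv : forall P f, vord P (t f) = vord (translate P beta) f.
Variable p : cpoint X.
Implicit Types (P Q R q : cpoint X) (f g h x y : X).
Local Notation C := (const X).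
Local Notation L3 := (<< p >> *+ 3 : {freeg (cpoint X) / int}).

Let unramified := quotient_unramified genusX beta2 beta_neq0 phiP tC tv p.
Let tK := translation_invol genusX beta2 tC tv p.
Let deg3 : deg L3 = 3. Proof. by rewrite degMn deg_pt. Qed.

Lemma vord_ge_pullback P n (g : Y) : vord_ge P n (pullback phi g) <-> vord_ge (phi P) n g.
Proof.
split=> [[/eqP|]|[->|]].
- by rewrite fmorph_eq0 => /eqP; left.
- by rewrite unramified; right.
- by rewrite rmorph0; left.
- by rewrite -unramified; right.
Qed.

Lemma has_value_pullback P (g : Y) c :
  has_value P (pullback phi g) c <-> has_value (phi P) g c.
Proof.
by rewrite /has_value -(pullback_const phi) -rmorphB; apply: vord_ge_pullback.
Qed.

(** The triple of minors is odd for the translation; it descends to the quotient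
    only after multiplication by another odd function. *)
Lemma exists_t_odd : exists2 eps, eps != 0 & t eps = - eps.
Proof.
have [|x [x0 Hx vx]] := Lspace_strict genusX p p (D := << p >> *+ 2).
  by rewrite degMn deg_pt.
exists (x - t x); last by rewrite rmorphB tK opprB.
have pp' : p <> translate p beta by move/esym; apply: translate_neq.
apply/eqP => /eqP; rewrite subr_eq0 => /eqP xt.
have := vord_geE x0 (Hx (translate p beta)).
by rewrite -tv -xt vx !coeff_mult_pt eqxx (introF eqP pp'); lia.
Qed.

Hypothesis two_neq0 : 2%:R != 0 :> k.

(** If all lines [i(P) i(P + beta)] passed through one point, the projection
    from it would give an invariant function with at most three poles. *)
Lemma invariant_ratio f g : Lspace L3 f -> Lspace L3 g -> g != 0 ->
  f * t g = g * t f -> exists c, f = C c * g.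
Proof.
move=> Hf Hg g0 fg; have [G HG] := div_exists genusX p g0.
have [->|f0] := eqVneq f 0; first by exists 0; rewrite rmorph0 mul0r.
have tg0 : t g != 0 by rewrite fmorph_eq0.
have [|||| c Hc] := @invariant_const _ _ genusX beta t beta2 beta_neq0 tC tv two_neq0 p
    (L3 + G) (f / g).
- by rewrite rmorphM fmorphV; apply: (mulfI g0); apply: (mulIf tg0);
     rewrite mulrA -fg; field; rewrite g0 tg0.
- by move=> P; rewrite coeffD HG; have := vord_geE g0 (Hg P); lia.
- by rewrite degD deg3 (deg_principal genusX g0 HG).
- move=> P; right; rewrite coeffD HG vord_div //.
  by have := vord_geE f0 (Hf P); lia.
by exists c; rewrite -Hc divfK.
Qed.

(** The hypothesis says that the lines joining [e(P)] to [e(P + beta)] pass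
    through [a]; [f] and [g] are the coordinates of the projection from [a]. *)
Lemma concurrent_dependent (e0 e1 e2 : X) (a0 a1 a2 : k) :
  Lspace L3 e0 -> Lspace L3 e1 -> Lspace L3 e2 -> a2 != 0 ->
  (forall c0 c1 c2, C c0 * e0 + C c1 * e1 + C c2 * e2 = 0 -> c0 = 0 /\ c1 = 0) ->
  C a0 * (e1 * t e2 - e2 * t e1) + C a1 * (e2 * t e0 - e0 * t e2) +
    C a2 * (e0 * t e1 - e1 * t e0) = 0 -> False.
Proof.
move=> H0 H1 H2 a20 free det0.
pose f := C a2 * e0 - C a0 * e2; pose g := C a2 * e1 - C a1 * e2.
have g0 : g != 0.
  apply/eqP => g0; have [] := free 0 a2 (- a1); last by move=> _ /eqP; rewrite (negPf a20).
  by rewrite -[RHS]g0 /g rmorph0 rmorphN; ring.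
have [|||c Hc] := @invariant_ratio f g _ _ g0.
- by apply: LspaceD; [|apply: LspaceN]; apply: LspaceZ.
- by apply: LspaceD; [|apply: LspaceN]; apply: LspaceZ.
- apply/eqP; rewrite -subr_eq0; apply/eqP.
  rewrite -[RHS](mulr0 (C a2)) -[X in _ = _ * X]det0.
  by rewrite /f /g !rmorphB !rmorphM !tC; ring.
have [] := free a2 (- (c * a2)) (c * a1 - a0); last by move/eqP; rewrite (negPf a20).
have : f - C c * g = 0 by rewrite Hc subrr.
by move=> <-; rewrite /f /g rmorphN rmorphB !rmorphM; ring.
Qed.

Variables (e : 'rV[X]_3) (i : cpoint X -> P2 k) (i' : cpoint Y -> dualP2 k).
Hypothesis be : is_basis_L L3 e.
Hypothesis ei : given_by e i.
Hypothesis i'P : forall P, line_through (i P) (i (translate P beta)) (i' (phi P)).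

Definition dual_triple : 'rV[X]_3 := cross e (map_mx t e).
Local Notation w := dual_triple.

Lemma dual_triple_odd j : t (w 0 j) = - w 0 j.
Proof.
by move: j; apply: ord3P; rewrite !crossE !mxE rmorphB !rmorphM !tK; ring.
Qed.

Lemma dual_triple_free a : a != 0 -> lincomb a w != 0.
Proof.
move=> /row3_neq0[j aj]; apply/eqP; rewrite /lincomb sum3 !crossE !mxE => det0.
have free := basis_lfree be.
have free3 c0 c1 c2 : C c0 * e 0 i0 + C c1 * e 0 i1 + C c2 * e 0 i2 = 0 ->
    [/\ c0 = 0, c1 = 0 & c2 = 0].
  move=> E; pose c : 'rV[k]_3 := \row_j [:: c0; c1; c2]`_j.
  have /free/rowP c0E : lincomb c e = 0 by rewrite -[RHS]E /lincomb sum3 !mxE.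
  by have := c0E i0; have := c0E i1; have := c0E i2; rewrite !mxE.
move: j aj; apply: ord3P => aj.
- apply: (@concurrent_dependent (e 0 i1) (e 0 i2) (e 0 i0) (a 0 i1) (a 0 i2) (a 0 i0)
    (be.1 _) (be.1 _) (be.1 _) aj); last by rewrite -[RHS]det0; ring.
  by move=> c0 c1 c2 E; have [] := free3 c2 c0 c1; rewrite // -[RHS]E; ring.
- apply: (@concurrent_dependent (e 0 i2) (e 0 i0) (e 0 i1) (a 0 i2) (a 0 i0) (a 0 i1)
    (be.1 _) (be.1 _) (be.1 _) aj); last by rewrite -[RHS]det0; ring.
  by move=> c0 c1 c2 E; have [] := free3 c1 c2 c0; rewrite // -[RHS]E; ring.
- apply: (@concurrent_dependent (e 0 i0) (e 0 i1) (e 0 i2) (a 0 i0) (a 0 i1) (a 0 i2)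
    (be.1 _) (be.1 _) (be.1 _) aj); last by rewrite -[RHS]det0; ring.
  by move=> c0 c1 c2 E; have [] := free3 c0 c1 c2.
Qed.

Section Descent.
Variables (eps : X) (g : 'rV[Y]_3).
Hypothesis eps0 : eps != 0.
Hypothesis gE : forall j, pullback phi (g 0 j) = eps * w 0 j.

(** Near [phi(P)] the dual map is the cross product of the local coordinates of
    [i] at [P] and at [P + beta]. *)
Lemma dual_local_coords P : exists (h : Y) (u : 'rV[k]_3), [/\ local_coords g (phi P) h u,
  val (i' (phi P)) = <[u]>%VS &
  vord (phi P) h = coeff P L3 + coeff (translate P beta) L3 - vord P eps].
Proof.
set P' := translate P beta.
have [h [u [Hu iP]]] := ei P; have [h' [u' [Hu' iP']]] := ei P'.
have D1 : 1 < deg L3 by rewrite deg3.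
have vh := coords_vord genusX p be D1 Hu; have vh' := coords_vord genusX p be D1 Hu'.
have [h0 _ _] := local_coords_vord Hu; have [h'0 _ _] := local_coords_vord Hu'.
have PP' : P <> P' by move/esym; apply: translate_neq.
have uu0 := coords_separate genusX p be deg3 PP' Hu Hu'.
have th'0 : t h' != 0 by rewrite fmorph_eq0.
have Hw j : has_value P (h * t h' * w 0 j) (cross u u' 0 j).
  apply: has_value_cross; first exact: Hu.2.
  move=> l; rewrite mxE -rmorphM; apply/(has_value_auto tC (tv P)); exact: Hu'.2.
have [pi0 vpi] := vord_normalized (phi P).
have pi00 : pi0 != 0 by apply/eqP => E; move: vpi; rewrite E vord0.
set n : int := coeff P L3 + coeff P' L3 - vord P eps.
pose z := pullback phi (pi0 ^ n) * eps / (h * t h').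
have b0 : pullback phi (pi0 ^ n) != 0 by rewrite fmorph_eq0 expfz_neq0.
have z0 : z != 0 by rewrite !mulf_neq0 // invr_eq0 mulf_neq0.
have vz : vord P z = 0.
  rewrite vord_div ?mulf_neq0 // !vordM // unramified vordXz // vpi tv vh vh'.
  by rewrite /n mulr1 subrK subrr.
have [|c zc] := @residue _ _ P z; first by right; rewrite vz.
have c0 : c != 0.
  by apply/eqP => c0; move: zc; rewrite c0 => /has_value0/(vord_geE z0); rewrite vz.
exists (pi0 ^ n), (c *: cross u u'); split.
- split=> [|j]; first by rewrite scaler_eq0 negb_or c0.
  apply/has_value_pullback; rewrite rmorphM gE [X in has_value _ _ X]mxE.
  have -> : pullback phi (pi0 ^ n) * (eps * w 0 j) = z * (h * t h' * w 0 j).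
    rewrite /z; move: (w 0 j) (pullback phi _) (t h') th'0 => W B K K0.
    by field; rewrite h0 K0.
  exact: has_valueM.
- have [a a0 la] := P2_vline (i' (phi P)); rewrite la.
  have [on on'] := i'P P.
  have au : \sum_(j < 3) a 0 j * u 0 j = 0.
    by apply: on; rewrite ?iP ?la memv_line.
  have au' : \sum_(j < 3) a 0 j * u' 0 j = 0.
    by apply: on'; rewrite ?iP' ?la memv_line.
  have [d d0 ->] := orthogonal_cross uu0 a0 au au'.
  by rewrite !vline_scale.
- by rewrite vordXz // vpi mulr1.
Qed.

Lemma dual_given_by : given_by g i'.
Proof.
move=> Q; have [P <-] := phi_surj phiP Q.
by have [h [u [Hu iP _]]] := dual_local_coords P; exists h, u.
Qed.

Lemma pullback_lincomb (a : 'rV[k]_3) : pullback phi (lincomb a g) = eps * lincomb a w.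
Proof.
rewrite /lincomb rmorph_sum mulr_sumr; apply: eq_bigr => j _.
by rewrite rmorphM (pullback_const phi) gE; ring.
Qed.

(** A line containing the image would give a linear relation between the minors. *)
Lemma dual_not_in_line (l : P2 k) : exists Q : cpoint Y, ~ on_line (i' Q) l.
Proof.
apply: contrapT => H; have {}H (Q : cpoint Y) : on_line (i' Q) l.
  by apply: contrapT => nl; apply: H; exists Q.
have [a a0 la] := P2_vline l; have /eqP[] := dual_triple_free a0.
apply: (almost_all_zero genusX p (s := [:: p; translate p beta])) => P.
move=> /notin_cons[Pp /notin_cons[Pp' _]].
have [h [u [Hu iP vh]]] := dual_local_coords P.
have P'p : translate P beta <> p.
  by move=> E; apply: Pp'; rewrite -E translate2K.
move: vh; rewrite !coeff_mult_pt (introF eqP (nesym Pp)) (introF eqP (nesym P'p)) => vh.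
have [h0 _ _] := local_coords_vord Hu.
have := has_value_lincomb a Hu.2; rewrite (_ : \sum_(j < 3) _ = 0); last first.
  by apply: (H (phi P)); rewrite ?iP ?la memv_line.
move=> /has_value_pullback; rewrite rmorphM pullback_lincomb => /has_value0.
have [->|w0] := eqVneq (lincomb a w) 0; first by left.
have ph0 : pullback phi h != 0 by rewrite fmorph_eq0.
move=> /(vord_geE (mulf_neq0 ph0 (mulf_neq0 eps0 w0))).
by rewrite !vordM ?mulf_neq0 // unramified vh => v1; right; lia.
Qed.

Lemma dual_flex q a : a != 0 -> vord_ge q 3 (lincomb a w) ->
  q <> p -> translate q beta <> p -> is_flex i' (phi q).
Proof.
move=> a0 Ha qp q'p; exists g; split; first exact: dual_given_by.
  exact: dual_not_in_line.
have [l la] := vline_P2 a0; exists l.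
have [h [u [Hu iP vh]]] := dual_local_coords q; exists h, u, a; split=> //.
apply/vord_ge_pullback; rewrite rmorphM pullback_lincomb mulrA.
have -> : 3%:Z = 0 + 3 by [].
apply: vord_geM => //; right; have [h0 _ _] := local_coords_vord Hu.
rewrite vordM ?fmorph_eq0 // unramified vh !coeff_mult_pt.
by rewrite (introF eqP (nesym qp)) (introF eqP (nesym q'p)); lia.
Qed.

End Descent.

Variables (s : {rmorphism X -> X}) (gamma : Pic X).
Hypothesis Hs : reflection p p s.
Hypothesis gamma2 : gamma *+ 2 = 0.
Hypothesis gamma_neq0 : gamma <> 0.
Hypothesis gamma_neq_beta : gamma <> beta.

(** On points, [2 p - P] translated by [beta] is [2 p - (P + beta)] as [2 beta = 0]. *)
Lemma reflection_translation f : s (t f) = t (s f).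
Proof.
have [sC _ _ sv] := Hs; apply: (eq_from_values genusX p) => P c.
have [P1 HP] := conj_pt_ex genusX p p P.
have HP' : conj_pt p p (translate P beta) (translate P1 beta).
  have d0 := two_torsion_deg0 genusX beta2.
  rewrite /conj_pt !divclD !(translateE genusX) // addrACA -mulr2n beta2 addr0.
  by rewrite -!divclD.
move=> /(has_value_auto sC (sv _ _ HP)) /(has_value_auto tC (tv P1)) H.
by apply/(has_value_auto tC (tv P))/(has_value_auto sC (sv _ _ HP')).
Qed.

Lemma translate_gamma_neq :
  translate p gamma <> p /\ translate (translate p gamma) beta <> p.
Proof.
have qE := translateE genusX p (two_torsion_deg0 genusX gamma2).
split=> E.
  by apply: gamma_neq0; move: qE; rewrite E -[LHS]addr0 => /addrI <-.
apply: gamma_neq_beta.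
have := translateE genusX (translate p gamma) (two_torsion_deg0 genusX beta2).
rewrite E qE -addrA -[LHS]addr0 => /addrI/esym/eqP.
rewrite addr_eq0 => /eqP ->; apply/eqP.
by rewrite eq_sym -addr_eq0 -[beta + beta]mulr2n beta2.
Qed.

(** The flex line at [phi(p + gamma)]: the minors [w] of the basis are those of
    [1, x, y] up to a linear change of coordinates, and two of the latter are
    odd for the reflection, which fixes [p + gamma]. *)
Lemma dual_flex_line : exists2 a, a != 0 & vord_ge (translate p gamma) 3 (lincomb a w).
Proof.
set q := translate p gamma.
have qE : divcl << q >> = divcl << p >> + gamma.
  by apply: translateE => //; apply: two_torsion_deg0 gamma2.
have Hq : conj_pt p p q q.
  by rewrite /conj_pt !divclD qE addrACA -[gamma + gamma]mulr2n gamma2 addr0.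
have [/nesym pq /nesym pq'] := translate_gamma_neq; rewrite -/q in pq pq'.
have [x [y [[Hx vx sx] [Hy vy sy]]]] := weierstrass_coords genusX two_neq0 Hs.
have regular n f : Lspace (<< p >> *+ n) f -> vord_ge q 0 f /\ vord_ge q 0 (t f).
  move=> Hf; split; last apply/(vord_ge_auto (tv q)).
    by have := Hf q; rewrite coeff_mult_pt (introF eqP pq) oppr0.
  by have := Hf (translate q beta); rewrite coeff_mult_pt (introF eqP pq') oppr0.
have [xq txq] := regular _ _ Hx; have [yq tyq] := regular _ _ Hy.
pose W0 := x * t y - y * t x; pose W1 := y - t y.
have sW0 : s W0 = - W0.
  by rewrite rmorphB !rmorphM !reflection_translation sx sy rmorphN /W0; ring.
have sW1 : s W1 = - W1.
  by rewrite rmorphB reflection_translation sy rmorphN /W1; ring.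
have [||b0 [b1 [b_neq0 Wq]]] := odd_combination two_neq0 Hs Hq sW0 sW1.
- by rewrite /W0 -[0]addr0; apply: vord_geB; apply: vord_geM.
- exact: vord_geB.
have /choice[A HA] (j : 'I_3) : exists A : k * k * k,
    e 0 j = C A.1.1 + C A.1.2 * x + C A.2 * y.
  by have [a [b [c E]]] := coords3 genusX Hx vx Hy vy (be.1 j); exists (a, b, c).
pose A0 j := (A j).1.1; pose A1 j := (A j).1.2; pose A2 j := (A j).2.
have eE j : e 0 j = C (A0 j) + C (A1 j) * x + C (A2 j) * y by apply: HA.
exists (\row_j (b0 * A0 j + b1 * A1 j)).
  (* [b0], [b1] are recovered by pairing with the coordinates of [1] and [x]. *)
  have dual a b : exists c : 'rV[k]_3,
      \sum_(j < 3) c 0 j * A0 j = a /\ \sum_(j < 3) c 0 j * A1 j = b.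
    have [|c [cE _]] := be.2 (C a + C b * x).
      move=> P; rewrite coeff_mult_pt; apply: vord_geD.
        by apply: vord_geW (vord_geC P a); case: eqP.
      apply/vord_geZ/(vord_geW _ (Hx P)); rewrite coeff_mult_pt.
      by case: eqP.
    exists c; have [|] := @coords3_free _ _ p x y vx vy
      (\sum_(j < 3) c 0 j * A0 j - a) (\sum_(j < 3) c 0 j * A1 j - b)
      (\sum_(j < 3) c 0 j * A2 j).
      move/eqP: cE; rewrite eq_sym -subr_eq0 => /eqP <-.
      rewrite /lincomb !sum3 !eE !rmorphB !rmorphD !rmorphM; ring.
    by move=> /eqP + /eqP + _; rewrite !subr_eq0 => /eqP -> /eqP ->.
  apply/eqP => /rowP a0.
  have pair (c : 'rV[k]_3) : b0 * (\sum_(j < 3) c 0 j * A0 j) +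
      b1 * (\sum_(j < 3) c 0 j * A1 j) = 0 :> k.
    rewrite !mulr_sumr -big_split /= big1 // => j _.
    transitivity (c 0 j * (b0 * A0 j + b1 * A1 j)); first by ring.
    by have := a0 j; rewrite !mxE => ->; rewrite mulr0.
  have [c [c0 c1]] := dual 1 0; have [d [d0' d1]] := dual 0 1.
  have := pair c; rewrite c0 c1 mulr1 mulr0 addr0 => b00.
  have := pair d; rewrite d0' d1 mulr1 mulr0 add0r => b10.
  by move: b_neq0; rewrite b00 b10 eqxx.
(* The minors of [e] are obtained from those of [1, x, y] by the cofactors of the
   matrix [A], and [a] is [(b0, b1, 0) A], so the determinant of [A] factors out. *)
pose det := A0 i0 * (A1 i1 * A2 i2 - A1 i2 * A2 i1)
  - A0 i1 * (A1 i0 * A2 i2 - A1 i2 * A2 i0) + A0 i2 * (A1 i0 * A2 i1 - A1 i1 * A2 i0).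
suff -> : lincomb (\row_j (b0 * A0 j + b1 * A1 j)) w = C det * (C b0 * W0 + C b1 * W1).
  exact: vord_geZ.
have teE j : t (e 0 j) = C (A0 j) + C (A1 j) * t x + C (A2 j) * t y.
  by rewrite eE !rmorphD !rmorphM !tC.
rewrite /lincomb sum3 !crossE !mxE !teE !eE /det /W0 /W1.
by rewrite !(rmorphB C, rmorphD C, rmorphM C); ring.
Qed.

End DualMap.

(** * Flexes of the dual map *)

Theorem theorem4 (R : realType) (F : curve R[i]) (genusF : has_genus F 1)
    (beta : Pic F) (beta2 : beta *+ 2 = 0) (beta_neq0 : beta <> 0)
    (H : Pic F) (degH : in_Pic_deg 3 H)
    (i : cpoint F -> P2 R[i]) (iH : linear_system_map H i)
    (F' : curve R[i]) (pi : cmorphism F F') (piP : quotient_by pi beta)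
    (gamma : Pic F) (gamma2 : gamma *+ 2 = 0)
    (gamma_neq0 : gamma <> 0) (gamma_neq_beta : gamma <> beta)
    (i' : cpoint F' -> dualP2 R[i])
    (i'P : forall p : cpoint F,
       line_through (i p) (i (translate p beta)) (i' (pi p)))
    (p : cpoint F) :
  is_flex i p -> is_flex i' (translate (pi p) (Pic_push pi gamma)).
Proof.
move=> flex_p; have two_neq0 : 2%:R != 0 :> R[i] by rewrite pnatr_eq0.
have [D [f [DH bf fi]]] := iH.
have D3 : deg D = 3.
  by have [E EH <-] := degH; apply: divcl_deg => //; rewrite DH.
have /divclP[h h0 Hh] := flex_class genusF p bf D3 fi flex_p.
have be := basis_scale h0 Hh bf; have ei := given_by_scale h0 fi.
have [t [tC tv]] := translation_ex genusF two_neq0 p (two_torsion_deg0 genusF beta2).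
have [s Hs] := reflection_ex genusF two_neq0 p p.
have tK := translation_invol genusF beta2 tC tv p.
have [eps eps0 t_eps] := exists_t_odd genusF beta2 beta_neq0 tC tv p.
set w := dual_triple t (h *: f).
have /choice[g0 Hg0] (j : 'I_3) : exists g, pullback pi g = eps * w 0 j.
  have [g ->] : exists g, eps * w 0 j = pullback pi g; last by exists g.
  apply/(invariant_pullback genusF piP tC tv p).
  by rewrite rmorphM t_eps (dual_triple_odd genusF beta2 tC tv p) mulrNN.
have gE j : pullback pi ((\row_j g0 j) 0 j) = eps * w 0 j by rewrite mxE Hg0.
have gamma_deg0 := two_torsion_deg0 genusF gamma2.
rewrite (translate_quotient genusF beta2 beta_neq0 piP tC tv p two_neq0 _ gamma_deg0).
have [a a0 Ha] := dual_flex_line genusF beta2 tC tv two_neq0 be Hs gamma2 gamma_neq0 gamma_neq_beta.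
have [qp q'p] := translate_gamma_neq genusF beta2 p gamma2 gamma_neq0 gamma_neq_beta.
exact: (dual_flex genusF beta2 beta_neq0 piP tC tv two_neq0 be ei i'P eps0 gE a0 Ha qp q'p).
Qed.
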